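(* Let $A\in\mathbb{C}^{m\times m}$ be a unitary matrix with no eigenvalues equal to $\pm i$. Let $n\in\mathbb{N}$ and $\Theta\in[0,\pi/2)$. Put $B=(A+A^* )/2$ and $\ell=\cos\Theta$. Then the iterations $$X_{k+1}=r_{2n+1}(X_k;\Theta_k),\quad X_0=A,\qquad \Theta_{k+1}=|\arg r_{2n+1}(e^{i\Theta_k};\Theta_k)|,\quad \Theta_0=\Theta,$$ and $$Y_{k+1}=\widehat{R}_{2n+1}(Y_k;\ell_k),\quad Y_0=B,\qquad \ell_{k+1}=\widehat{R}_{2n+1}(\ell_k;\ell_k),\quad \ell_0=\ell,$$ with $r_{2n+1}$ and $\widehat{R}_{2n+1}$ the rational functions defined in the context, generate sequences satisfying $$Y_k=\tfrac12(X_k+X_k^* )\quad\text{and}\quad \ell_k=\cos\Theta_k$$ for every $k\ge 0$.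
   Context: $\arg$ takes values in $(-\pi,\pi]$; rational functions are applied to matrices in the usual way. Definition of $r_{2n+1}$: $\mathrm{sn}(\cdot,\ell),\mathrm{cn}(\cdot,\ell),\mathrm{dn}(\cdot,\ell)$ denote Jacobi's elliptic functions with modulus $\ell$, and $K(\ell)=\int_0^{\pi/2}(1-\ell^2\sin^2\theta)^{-1/2}\,d\theta$. For $\Theta\in[0,\pi/2)$ put $\ell=\cos\Theta$, $\ell'=\sqrt{1-\ell^2}=\sin\Theta$, and for $j=1,\dots,n$ put $v_j=\frac{2j-1}{2n+1}K(\ell')$ and $$a_j=a_j(\Theta)=\left(\frac{\ell\,\mathrm{sn}(v_j,\ell')+\mathrm{dn}(v_j,\ell')}{\mathrm{cn}(v_j,\ell')}\right)^{2(-1)^{j+n}} .$$ (For $\Theta=0$ this uses modulus $\ell'=0$, where $\mathrm{sn}=\sin$, $\mathrm{cn}=\cos$, $\mathrm{dn}=1$, $K(0)=\pi/2$.) Then $$r_{2n+1}(z;\Theta)=z\prod_{j=1}^n\frac{z^2+a_j(\Theta)}{1+a_j(\Theta)z^2}.$$ Definition of $\widehat{R}_{2n+1}$: for odd $M=2n+1$ and $\ell\in(0,1)$, let $\mathcal{R}_{M,M}$ be the set of real rational functions $p/q$ with $p,q$ polynomials of degree at most $M$, and let $$R_M(\cdot\,;\ell)=\mathop{\mathrm{arg\,min}}_{R\in\mathcal{R}_{M,M}}\ \max_{x\in[-1,-\ell]\cup[\ell,1]}|R(x)-\mathrm{sign}(x)|,$$ where the minimizer meant is the one vanishing at $x=0$.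 Set $$\widehat{R}_M(x;\ell)=\frac{R_M(x;\ell)}{\max_{y\in[\ell,1]}R_M(y;\ell)}\ \text{ if }\ell\in(0,1),\qquad \widehat{R}_M(x;1)=x\,p_n(x^2),$$ where $p_n$ is the type-$(n,n)$ Padé approximant of $z^{-1/2}$ at $z=1$ (the rational function with numerator and denominator of degree at most $n$ that agrees with $z^{-1/2}$ up to $O((z-1)^{2n+1})$ at $z=1$). *)

(* Defs.v *)
From HB Require Import structures.
From mathcomp Require Import all_boot all_order all_algebra.
From mathcomp Require Import complex.
From mathcomp Require Import all_classical all_reals all_analysis.

Set Implicit Arguments.
Unset Strict Implicit.
Unset Printing Implicit Defensive.

Import Order.TTheory GRing.Theory Num.Theory.
Import numFieldNormedType.Exports.

#[global] Open Scope classical_set_scope.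
#[global] Open Scope complex_scope.
#[global] Open Scope ring_scope.
#[global] Open Scope sesquilinear_scope.

Section RationalFunctions.
Variable F : fieldType.

(* A pair (p, q) stands for the rational function p / q. *)
Definition ratfun := ({poly F} * {poly F})%type.

Definition rf_eval (r : ratfun) (x : F) : F := r.1.[x] / r.2.[x].

Definition rf_defined (r : ratfun) (x : F) : bool := r.2.[x] != 0.

Definition rf_eval_mx (m : nat) (r : ratfun) (X : 'M[F]_m.+1) : 'M[F]_m.+1 :=
  horner_mx X r.1 *m invmx (horner_mx X r.2).

Definition rf_defined_mx (m : nat) (r : ratfun) (X : 'M[F]_m.+1) : bool :=
  horner_mx X r.2 \in unitmx.

(* p / q in lowest terms with deg p <= M and deg q <= N.  Every rational
   function of type (M, N) has such a representation, unique up to a common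
   scalar factor, and its poles are then exactly the zeros of q. *)
Definition rf_type (M N : nat) (r : ratfun) : Prop :=
  [/\ (size r.1 <= M.+1)%N, (size r.2 <= N.+1)%N, r.2 != 0 & coprimep r.1 r.2].

End RationalFunctions.

Section Iterations.
Variable R : realType.
Implicit Types (k u l Theta x : R) (n M : nat).

Definition rf_complex (r : ratfun R) : ratfun R[i] :=
  (map_poly (real_complex R) r.1, map_poly (real_complex R) r.2).

Definition expi (t : R) : R[i] := cos t +i* sin t.

(* The value at z = 0 is irrelevant. *)
Definition arg (z : R[i]) : R :=
  xget 0 [set t | - pi < t <= pi /\ z = `|z| * expi t].

(* Incomplete elliptic integral of the first kind with modulus k, extended to negative
   amplitudes as an odd function. *)
Definition ellF k (phi : R) : R :=
  Num.sg phi *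
  Rintegral lebesgue_measure `[0, `|phi|]
    (fun t : R => (Num.sqrt (1 - k ^+ 2 * sin t ^+ 2))^-1).

Definition ellK k : R := ellF k (pi / 2).

(* The amplitude: for 0 <= k < 1, ellF k is a bijection of R and jacobi_am
   its inverse. *)
Definition jacobi_am u k : R := xget 0 [set phi | ellF k phi = u].
Definition jacobi_sn u k : R := sin (jacobi_am u k).
Definition jacobi_cn u k : R := cos (jacobi_am u k).
Definition jacobi_dn u k : R := Num.sqrt (1 - k ^+ 2 * jacobi_sn u k ^+ 2).

Definition a_coef n Theta (j : nat) : R :=
  let l := cos Theta in
  let l' := Num.sqrt (1 - l ^+ 2) in
  let v := (2 * j - 1)%:R / (2 * n + 1)%:R * ellK l' in
  ((l * jacobi_sn v l' + jacobi_dn v l') / jacobi_cn v l')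
    ^ (2 * (-1) ^+ (j + n) : int).

Definition r_odd n Theta : ratfun R :=
  ('X * \prod_(1 <= j < n.+1) ('X^2 + (a_coef n Theta j)%:P),
   \prod_(1 <= j < n.+1) (1 + a_coef n Theta j *: 'X^2)).

(* The supremum over E of |r - f|, a pole of r counting as +oo. *)
Definition sup_dist (E : set R) (r : ratfun R) (f : R -> R) : \bar R :=
  ereal_sup [set (if rf_defined r x then `|rf_eval r x - f x|%:E else +oo%E)
            | x in E].

Definition best_sign_approx M l (r : ratfun R) : Prop :=
  let E := `[-1, - l] `|` `[l, 1] in
  rf_type M M r /\
  forall s, rf_type M M s ->
    (sup_dist E r Num.sg <= sup_dist E s Num.sg)%E.

(* The default value (0, 0) is defined nowhere in the sense of rf_defined. *)
Definition minimax_sign M l : ratfun R :=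
  xget (0, 0) [set r | best_sign_approx M l r /\ root r.1 0].

(* Type (n, n) Pade approximant of z^(-1/2) at z = 1. *)
Definition is_pade_invsqrt n (r : ratfun R) : Prop :=
  rf_type n n r /\
  (fun z : R^o => rf_eval r z - (Num.sqrt z)^-1 : R^o)
    =O_ (1 : R^o) (fun z : R^o => (z - 1) ^+ (2 * n + 1) : R^o).

Definition pade_invsqrt n : ratfun R := xget (0, 0) [set r | is_pade_invsqrt n r].

(* Meant for 0 < l <= 1. *)
Definition Rhat_odd n l : ratfun R :=
  if l == 1 then
    let p := pade_invsqrt n in ('X * (p.1 \Po 'X^2), p.2 \Po 'X^2)
  else
    let r := minimax_sign (2 * n + 1) l in
    ((sup [set rf_eval r y | y in `[l, 1]])^-1 *: r.1, r.2).

End Iterations.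

(* Main.v *)
Require Import Defs.
From mathcomp Require Import all_boot all_order all_algebra.
From mathcomp Require Import complex.
From mathcomp Require Import all_classical all_reals all_analysis.
From mathcomp Require Import ring lra zify.
Import Order.TTheory GRing.Theory Num.Theory.
Import numFieldNormedType.Exports.

(** Both iterations are one and the same map seen on the unit circle and on its
    projection to the real axis.  Everything reduces to a scalar identity: if
    z = x + iy has modulus 1, then r(z; Theta) has modulus 1 and its real part
    is the value at x of the rational function attached to l = cos Theta.
    Diagonalizing the unitary matrix A transports the identity from the
    eigenvalues to the matrices, and taking z = exp (i Theta) gives the relation
    between the two parameters.

    Elementary algebra ([circle_mapE]) shows that the real part of r(z; Theta)
    is an odd rational function S(x) = P(x) / Q(x) of type (2n+1, 2n) with Q > 0.
    It remains to see that S is the scaled Zolotarev function.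

    - The arc |arg z| <= Theta is parametrized by z(u) = dn u + i k sn u with
      modulus k = sin Theta.  By the addition theorems ([snD], [dnD]) the product
      z(u+t) z(u-t) is (z^2 + b) / (1 + b z^2) with b = (1 - cn t) / (1 + cn t)
      ([zeta_mul]), and the coefficients a_j are exactly the numbers b or 1/b for
      t = ih, h = 2K / (2n+1) ([a_coefE]).  Hence r(z(u)) is the product of the
      z(u + ih)^((-1)^i), |i| <= n.  This product telescopes: shifting u by h
      inverts it ([alt_prod_anti]).  So C(u) = S(dn u) is even and h-periodic.

    - Such a function takes every value it takes on [0, h/2] at n+1 points of
      [0, K] per preimage.  Counting zeros of P - c Q then makes C injective on
      [0, h/2] and positive: S oscillates 2n+2 times between mu and 1
      on [l, 1], which after the scaling 2 / (1 + mu) is equioscillation about 1.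

    - A rational function that equioscillates this way is the best approximation
      of the sign vanishing at 0, and the only one ([minimax_sign_spec]).  The
      sign jumps across a gap where competitors may have poles; a competitor with
      a pole there is inverted by w -> (1 - e^2) / w, which preserves the error.

    - For Theta = 0 the elliptic functions degenerate and the product is computed
      with roots of unity: S(x) = ((1+x)^N - (1-x)^N) / ((1+x)^N + (1-x)^N) with
      N = 2n+1 ([cos_num_den0]), which agrees with 1 at x = 1 to order N.  This
      is the defining property of the Pade approximant. *)

Set Implicit Arguments.
Unset Strict Implicit.
Unset Printing Implicit Defensive.

Local Open Scope ring_scope.

(** * Weakly alternating polynomials *)

Section Alternation.
Variable F : realFieldType.
Implicit Types (t : nat -> F) (p : {poly F}).

Lemma sum_gtn i m : (i <= m)%N -> (\sum_(j < m.+1) (i < j) = m - i)%N.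
Proof.
elim: m => [|m IHm] im; rewrite big_ord_recr /=.
  by rewrite big_ord0 add0n; lia.
move: im; rewrite leq_eqVlt => /predU1P[->|im].
  by rewrite big1 => [|j _]; [lia|have := ltn_ord j; lia].
by rewrite IHm //; lia.
Qed.

(** The factors with j > i are the negative ones, and there are m - i of them. *)
Lemma sign_node_prod t m (i : 'I_m.+1) :
  {homo t : j k / (j < k)%N >-> j < k} ->
  0 < (-1) ^+ (m - i) * \prod_(j < m.+1 | j != i) (t i - t j).
Proof.
move=> tinc; rewrite -sum_gtn -1?ltnS //.
rewrite (bigD1 i) //= ltnn add0n -prodrXr -big_split /=.
apply: prodr_gt0 => j; rewrite -val_eqE neq_ltn /= => /orP[ji|ij].
  by rewrite ltnNge (ltnW ji) expr0 mul1r subr_gt0 tinc.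
by rewrite ij expr1 mulN1r opprB subr_gt0 tinc.
Qed.

(** The coefficient of degree m of the Lagrange interpolant is the sum of the
    p(t_i) / w_i, and it is 0 because p has smaller degree.  The weights w_i
    alternate in sign, so weakly alternating values give terms of one sign, all
    of which must vanish.  Allowing weak inequalities spares the count of
    multiple zeros that equioscillation arguments usually require. *)
Lemma weak_alternation_eq0_glob t m p :
  {homo t : i j / (i < j)%N >-> i < j} -> (size p <= m)%N ->
  (forall i, (i <= m)%N -> 0 <= (-1) ^+ i * p.[t i]) -> p = 0.
Proof.
move=> tinc sp alt.
have tinj : injective t.
  move=> i j; case: (ltngtP i j) => // /tinc lt e; move: lt; rewrite e ltxx //.
pose w (i : 'I_m.+1) := (\prod_(j < m.+1 | j != i) (t i - t j)).
have wE (i : 'I_m.+1) : 0 <= (-1) ^+ m * (p.[t i] * (w i)^-1).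
  have := sign_node_prod i tinc; rewrite -/(w i) => w0.
  have wn0 : w i != 0 by apply: contraTneq w0 => ->; rewrite mulr0 ltxx.
  have -> : (-1) ^+ m * (p.[t i] * (w i)^-1) =
      ((-1) ^+ i * p.[t i]) * ((-1) ^+ (m - i) * w i)^-1.
    have im : (i <= m)%N by rewrite -ltnS.
    have -> : (-1) ^+ m = (-1) ^+ i * (-1) ^+ (m - i) :> F.
      by rewrite -exprD subnKC.
    by rewrite invfM invr_sign; ring.
  by rewrite mulr_ge0 ?alt // -1?ltnS // invr_ge0 ltW.
have s0 : \sum_(i < m.+1) (-1) ^+ m * (p.[t i] * (w i)^-1) = 0.
  rewrite -mulr_sumr.
  suff -> : \sum_(i < m.+1) p.[t i] / w i = p`_m by rewrite nth_default ?mulr0.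
  rewrite [in RHS](lagrange_gen (ltn0Sn m) tinj (leqW sp)) coef_sum.
  apply: eq_bigr => i _; rewrite coefCM lagrangeE // coefCM.
  congr (_ * _); rewrite horner_prod.
  have -> : \prod_(j < m.+1 | j != i) ('X - (t j)%:P).[t i] = w i.
    by apply: eq_bigr => j _; rewrite hornerXsubC.
  set q : {poly F} := \prod_(j < m.+1 | _) _.
  have qm : q \is monic by apply: monic_prod => j _; exact: monicXsubC.
  have sq : size q = m.+1.
    rewrite size_prod => [|j _]; last by rewrite polyXsubC_eq0.
    rewrite (eq_bigr (fun=> (2 * 1)%N)) => [|j _]; last by rewrite size_XsubC.
    by rewrite -big_distrr /= sum1_card cardC1 card_ord /=; lia.
  by have := monicP qm; rewrite lead_coefE sq /= => ->; rewrite mulr1.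
have root_t (i : 'I_m.+1) : p.[t i] = 0.
  have /eqP := psumr_eq0P (P := xpredT) (fun i _ => wE i) s0 (i := i) isT.
  rewrite mulf_eq0 signr_eq0 /= mulf_eq0 invr_eq0 => /orP[/eqP //|/eqP w0].
  have := sign_node_prod i tinc; rewrite -/(w i) w0 mulr0 ltxx //.
apply: (@roots_geq_poly_eq0 _ p [seq t i | i <- iota 0 m.+1]).
- apply/allP => x /mapP[l]; rewrite mem_iota => /andP[_ lm] ->.
  by apply/rootP; exact: (root_t (Ordinal lm)).
- by rewrite map_inj_uniq ?iota_uniq.
- by rewrite size_map size_iota leqW.
Qed.

(** Reduction to nodes that increase on all of nat: beyond m they are continued
    with unit steps. *)
Lemma weak_alternation_eq0 t m p :
  (forall i j, (i < j)%N -> (j <= m)%N -> t i < t j) -> (size p <= m)%N ->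
  (forall i, (i <= m)%N -> 0 <= (-1) ^+ i * p.[t i]) -> p = 0.
Proof.
move=> tinc sp alt.
pose u i := t (minn i m) + (i - m)%:R.
have uE i : (i <= m)%N -> u i = t i.
  by move=> im; rewrite /u (minn_idPl im) (eqP im) addr0.
apply: (@weak_alternation_eq0_glob u m) => // [i j ij|i im]; last first.
  by rewrite uE // alt.
rewrite /u; have [jm|mj] := leqP j m.
  have im : (i <= m)%N by lia.
  by rewrite (minn_idPl im) (eqP im) (eqP jm) !addr0 tinc.
have [mi|im] := leqP m i.
  by rewrite ltrD2l ltr_nat; lia.
have -> : (i - m = 0)%N by lia.
by rewrite addr0 ltr_wpDr ?tinc.
Qed.

End Alternation.

(** * Best approximation of the sign on two bands *)

Section Minimax.
Variable R : realType.
Implicit Types (p q : {poly R}) (x : R).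

Definition bands (l : R) : set R := `[-1, - l] `|` `[l, 1].

Lemma bandsP (l x : R) : bands l x <-> - 1 <= x <= - l \/ l <= x <= 1.
Proof. by rewrite /bands /= !in_itv. Qed.

Lemma sup_dist_leP (E : set R) (r : ratfun R) (f : R -> R) (e : R) :
  (sup_dist E r f <= e%:E)%E <->
  forall x, E x -> rf_defined r x /\ `|rf_eval r x - f x| <= e.
Proof.
split=> [h x Ex|h].
  have : ((if rf_defined r x then `|rf_eval r x - f x|%:E else +oo) <= e%:E)%E.
    by apply: le_trans h; apply: ereal_sup_ubound; exists x.
  by case: ifP => // _; rewrite lee_fin.
apply: ge_ereal_sup => _ [x Ex <-]; have [-> hx] := h x Ex.
by rewrite lee_fin.
Qed.

Lemma same_sign_no_root q (a b : R) : a <= b ->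
  (forall x, a <= x <= b -> q.[x] != 0) ->
  forall x y, a <= x <= b -> a <= y <= b -> 0 < q.[x] * q.[y].
Proof.
move=> ab nz x y hx hy.
wlog xy : x y hx hy / x <= y.
  by move=> hw; case: (leP x y) => [|/ltW] h; [|rewrite mulrC]; apply: hw.
rewrite ltNge; apply/negP => /(polyrcf.poly_ivt xy)[z /andP[]] /=.
rewrite !bnd_simp => xz zy; apply/negP/nz.
move: hx hy => /andP[? ?] /andP[? ?]; apply/andP; split; lra.
Qed.

(** From here on P / Q is an odd function without poles that equioscillates
    about 1 with amplitude e at the points y_0 < ... < y_M of [l, 1].  The points
    y_j and their opposites, listed in increasing order by t, form an alternant
    of 2M + 2 points for the sign function. *)
Variables (l e : R) (M : nat) (P Q : {poly R}) (y : nat -> R).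
Hypotheses (l_gt0 : 0 < l) (l_le1 : l <= 1) (e_gt0 : 0 < e) (e_lt1 : e < 1).
Hypotheses (oddM : odd M) (sP : (size P <= M.+1)%N) (sQ : (size Q <= M.+1)%N).
Hypothesis Q_gt0 : forall x, 0 < Q.[x].
Hypothesis P_odd : forall x, P.[- x] = - P.[x].
Hypothesis Q_even : forall x, Q.[- x] = Q.[x].
Hypothesis y_inc : forall i j, (i < j)%N -> (j <= M)%N -> y i < y j.
Hypothesis y_itv : forall j, (j <= M)%N -> l <= y j <= 1.
Hypothesis y_val : forall j, (j <= M)%N -> P.[y j] / Q.[y j] = 1 - (-1) ^+ j * e.
Hypothesis close : forall x, l <= x <= 1 -> `|P.[x] / Q.[x] - 1| <= e.

Let t i : R := if (i <= M)%N then - y (M - i)%N else y (i - M.+1)%N.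

Let t_inc i j : (i < j)%N -> (j <= (2 * M).+1)%N -> t i < t j.
Proof.
move=> ij jM; rewrite /t; case: (leqP j M) => [jM'|Mj].
  have -> : (i <= M)%N by lia.
  by rewrite ltrN2 y_inc //; lia.
case: (leqP i M) => iM; last by rewrite y_inc //; lia.
have /andP[h1 _] := y_itv (leq_subr i M).
have jM' : (j - M.+1 <= M)%N by lia.
have /andP[h2 _] := y_itv jM'.
by move: l_gt0 h1 h2; lra.
Qed.

Let t_bands i : (i <= (2 * M).+1)%N -> bands l (t i).
Proof.
move=> im; apply/bandsP; rewrite /t; case: (leqP i M) => iM; [left|right].
  have /andP[h1 h2] := y_itv (leq_subr i M).
  by rewrite !lerN2 h1 h2.
by apply: y_itv; lia.
Qed.

Let t_val i : (i <= (2 * M).+1)%N ->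
  P.[t i] / Q.[t i] - Num.sg (t i) = - ((-1) ^+ i * e).
Proof.
move=> im; rewrite /t; case: (leqP i M) => iM.
  have iM' := leq_subr i M.
  have /andP[h1 _] := y_itv iM'.
  rewrite sgrN gtr0_sg; last by apply: lt_le_trans h1.
  rewrite P_odd Q_even mulNr (y_val iM') -[in RHS]signr_odd -(signr_odd _ (M - i)).
  by rewrite oddB // oddM; case: (odd i); rewrite ?expr0 ?expr1; ring.
have iM' : (i - M.+1 <= M)%N by lia.
have /andP[h1 _] := y_itv iM'.
rewrite gtr0_sg; last by apply: lt_le_trans h1.
rewrite (y_val iM') -[in RHS]signr_odd -signr_odd.
by rewrite oddB //= oddM /=; case: (odd i); rewrite ?expr0 ?expr1; ring.
Qed.

(** At the alternant, P / Q - p / q has weakly alternating signs because p / q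
    stays within the error that P / Q attains there.  If q does not change sign
    over the gap, the same holds for the polynomial P q - p Q, whose degree is
    too small for 2M + 2 weak alternations. *)
Lemma close_same_sign p q :
  (size p <= M.+1)%N -> (size q <= M.+1)%N ->
  (forall x, bands l x -> q.[x] != 0) ->
  (forall x, bands l x -> `|p.[x] / q.[x] - Num.sg x| <= e) ->
  0 < q.[l] * q.[- l] -> P * q = p * Q.
Proof.
move=> sp sq q_neq0 pq_close qll.
have q_sign x : bands l x -> 0 < q.[l] * q.[x].
  move/bandsP=> [hx|hx].
    have h : 0 < q.[- l] * q.[x].
      apply: (@same_sign_no_root q (-1) (-l)) => //; first by rewrite lerN2.
        by move=> z hz; apply: q_neq0; apply/bandsP; left.
      by rewrite lerN2 l_le1 lexx.
    have q2 : 0 < q.[- l] ^+ 2.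
      by rewrite exprn_even_gt0 //=; apply: contraTneq qll => ->; rewrite mulr0 ltxx.
    rewrite -(pmulr_rgt0 _ q2).
    have -> : q.[- l] ^+ 2 * (q.[l] * q.[x]) =
        (q.[l] * q.[- l]) * (q.[- l] * q.[x]) by ring.
    exact: mulr_gt0.
  apply: (@same_sign_no_root q l 1) => //; last by rewrite lexx l_le1.
  by move=> z hz; apply: q_neq0; apply/bandsP; right.
have ql_neq0 : q.[l] != 0.
  by apply: contraTneq qll => ->; rewrite mul0r ltxx.
apply/eqP; rewrite -subr_eq0; apply/eqP.
suff h : (- q.[l]) *: (P * q - p * Q) = 0.
  by apply/eqP; move/eqP: h; rewrite scaler_eq0 oppr_eq0 (negPf ql_neq0).
apply: (weak_alternation_eq0 t_inc).
  apply: (leq_trans (size_scale_leq _ _)).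
  apply: (leq_trans (size_polyD _ _)); rewrite size_polyN geq_max.
  by apply/andP; split; apply: (leq_trans (size_polyMleq _ _));
    [move: sP sq|move: sp sQ]; rewrite -!subn1; move: (size _) (size _) => a b; lia.
move=> i im; have Et := t_bands im.
rewrite hornerZ hornerD hornerN !hornerM.
have qt := q_sign _ Et; have qt0 := q_neq0 _ Et; have Qt := Q_gt0 (t i).
have -> : (-1) ^+ i * (- q.[l] * (P.[t i] * q.[t i] - p.[t i] * Q.[t i])) =
   (Q.[t i] * (q.[l] * q.[t i])) *
    ((-1) ^+ i * ((p.[t i] / q.[t i] - Num.sg (t i)) -
                (P.[t i] / Q.[t i] - Num.sg (t i)))).
  by field; rewrite qt0 gt_eqF.
apply: mulr_ge0; first by apply: mulr_ge0; exact: ltW.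
rewrite (t_val im) opprK mulrDr mulrA -expr2 sqrr_sign mul1r -signr_odd.
have := pq_close _ Et; rewrite ler_norml => /andP[].
by case: (odd i); rewrite ?expr0 ?expr1; lra.
Qed.

(** When q changes sign over the gap, p does not, since p / q itself changes
    sign.  The involution w -> (1 - e^2) / w preserves both [1-e, 1+e] and its
    opposite, so (1 - e^2) q / p is as close to the sign as p / q, and its
    denominator does not change sign. *)
Lemma close_dichotomy p q :
  (size p <= M.+1)%N -> (size q <= M.+1)%N ->
  (forall x, bands l x -> q.[x] != 0) ->
  (forall x, bands l x -> `|p.[x] / q.[x] - Num.sg x| <= e) ->
  P * q = p * Q \/ P * p = ((1 - e ^+ 2) *: q) * Q.
Proof.
move=> sp sq q_neq0 pq_close.
have bl : bands l l by apply/bandsP; right; rewrite lexx.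
have bNl : bands l (- l) by apply/bandsP; left; rewrite lexx lerN2 l_le1.
have [qs|] := ltP 0 (q.[l] * q.[- l]); first by left; exact: close_same_sign.
rewrite le_eqVlt mulf_eq0 (negPf (q_neq0 _ bl)) (negPf (q_neq0 _ bNl)) /= => qs.
right.
have e2 : 0 < 1 - e ^+ 2.
  by rewrite subr_gt0 exprn_ilt1 ?(ltW e_gt0).
have s_sign x : bands l x -> 0 < Num.sg x * (p.[x] / q.[x]).
  move=> bx; have := pq_close _ bx; move/bandsP: bx => [] hx.
    rewrite ltr0_sg; last by move: l_gt0 hx => ? /andP[]; lra.
    by rewrite ler_norml => /andP[]; move: e_lt1; lra.
  rewrite gtr0_sg; last by move: l_gt0 hx => ? /andP[]; lra.
  by rewrite ler_norml => /andP[]; move: e_lt1; lra.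
have p_neq0 x : bands l x -> p.[x] != 0.
  by move=> /s_sign; apply: contraTneq => ->; rewrite mul0r mulr0 ltxx.
apply: close_same_sign => //.
- exact: leq_trans (size_scale_leq _ _) _.
- move=> x bx; have q0 := q_neq0 _ bx; have p0 := p_neq0 _ bx.
  have := pq_close _ bx; have := s_sign _ bx.
  rewrite hornerZ -mulrA -[q.[x] / p.[x]]invrK invf_div.
  set s := p.[x] / q.[x] => s0.
  have sn0 : s != 0 by apply: contraTneq s0 => ->; rewrite mulr0 ltxx.
  have [hx|hx] : Num.sg x = 1 \/ Num.sg x = -1.
    by move/bandsP: bx => [] /andP[h1 h2]; [right; apply: ltr0_sg|left; apply: gtr0_sg];
      move: l_gt0; lra.
    move: s0; rewrite hx mul1r => s0.
    have -> : (1 - e ^+ 2) / s - 1 = (1 - e ^+ 2 - s) / s by field.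
    rewrite normrM normfV (gtr0_norm s0) ler_pdivrMr // !ler_norml => /andP[h1 h2].
    by apply/andP; split; move: e_gt0 e_lt1; nra.
  move: s0; rewrite hx mulN1r oppr_gt0 => s0.
  have -> : (1 - e ^+ 2) / s - -1 = (1 - e ^+ 2 + s) / s by field.
  rewrite normrM normfV (ltr0_norm s0) ler_pdivrMr ?oppr_gt0 // !ler_norml => /andP[h1 h2].
  by apply/andP; split; move: e_gt0 e_lt1; nra.
- have := s_sign _ bl; have := s_sign _ bNl.
  rewrite sgrN (gtr0_sg l_gt0) mulN1r mul1r => h1 h2.
  have -> : p.[l] * p.[- l] =
      (p.[l] / q.[l]) * (- (p.[- l] / q.[- l])) * (- (q.[l] * q.[- l])).
    by field; rewrite !q_neq0.
  apply: mulr_gt0; first by apply: mulr_gt0.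
  by rewrite oppr_gt0.
Qed.

(** In both cases of the dichotomy the error of p / q at y_0 is e, because the
    values 1 - e and 1 + e are exchanged by the involution. *)
Lemma close_attains p q :
  (size p <= M.+1)%N -> (size q <= M.+1)%N ->
  (forall x, bands l x -> q.[x] != 0) ->
  (forall x, bands l x -> `|p.[x] / q.[x] - Num.sg x| <= e) ->
  exists2 x, bands l x & e <= `|p.[x] / q.[x] - Num.sg x|.
Proof.
move=> sp sq q_neq0 pq_close.
have b0 : bands l (y 0%N) by apply/bandsP; right; exact: y_itv.
have q0 := q_neq0 _ b0; have Q0 := Q_gt0 (y 0%N).
have y0 : 0 < y 0%N.
  by have /andP[] := y_itv (leq0n M); move: l_gt0; lra.
have := y_val (leq0n M); rewrite expr0 mul1r => Py.
exists (y 0%N) => //; rewrite gtr0_sg //.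
have [] := close_dichotomy sp sq q_neq0 pq_close =>
    /(congr1 (fun f : {poly R} => f.[y 0%N])); rewrite !hornerM ?hornerZ => h.
  have -> : p.[y 0%N] / q.[y 0%N] = 1 - e.
    rewrite -Py; apply/eqP; rewrite eqr_div //; last by rewrite gt_eqF.
    by rewrite -h.
  by rewrite addrAC subrr add0r normrN (gtr0_norm e_gt0).
have P0 : P.[y 0%N] = (1 - e) * Q.[y 0%N].
  by rewrite -Py divfK ?gt_eqF.
have -> : p.[y 0%N] / q.[y 0%N] = 1 + e.
  apply/eqP; rewrite -subr_eq0; apply/eqP.
  apply: (@mulfI _ ((1 - e) * Q.[y 0%N] * q.[y 0%N])).
    apply: mulf_neq0 => //; apply: mulf_neq0; rewrite gt_eqF ?subr_gt0 //.
  rewrite mulr0 mulrBr.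
  transitivity (((1 - e) * Q.[y 0%N]) * p.[y 0%N] - (1 - e ^+ 2) * q.[y 0%N] * Q.[y 0%N]).
    by field.
  by rewrite -P0 h subrr.
by rewrite addrAC subrr add0r (gtr0_norm e_gt0).
Qed.

(** P / Q may not be in lowest terms; the reduced fraction is the witness. *)
Let g := gcdp P Q.
Let r0 : ratfun R := (P %/ g, Q %/ g).

Let Q_neq0 : Q != 0.
Proof. by apply: contraTneq (Q_gt0 0) => ->; rewrite horner0 ltxx. Qed.

Let g_neq0 : g != 0.
Proof. by rewrite gcdp_eq0 (negPf Q_neq0) andbF. Qed.

Let gP : P = r0.1 * g. Proof. by rewrite /r0 /= divpK // dvdp_gcdl. Qed.
Let gQ : Q = r0.2 * g. Proof. by rewrite /r0 /= divpK // dvdp_gcdr. Qed.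

Let r0_type : rf_type M M r0.
Proof.
split; rewrite /r0 /=.
- by apply: leq_trans sP; apply: leq_divp.
- by apply: leq_trans sQ; apply: leq_divp.
- by apply: contraNneq Q_neq0 => h; rewrite gQ /= h mul0r.
- by rewrite coprimep_div_gcd // Q_neq0 orbT.
Qed.

Let r0_defined x : rf_defined r0 x.
Proof.
rewrite /rf_defined; have := Q_gt0 x; rewrite gQ hornerM.
by apply: contraTneq => ->; rewrite mul0r ltxx.
Qed.

Let r0_eval x : rf_eval r0 x = P.[x] / Q.[x].
Proof.
rewrite /rf_eval gP gQ !hornerM; have := r0_defined x; rewrite /rf_defined => h.
have : g.[x] != 0.
  by have := Q_gt0 x; rewrite gQ hornerM; apply: contraTneq => ->; rewrite mulr0 ltxx.
by move=> h'; field; rewrite h h'.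
Qed.

Let r0_dist : (sup_dist (bands l) r0 Num.sg <= e%:E)%E.
Proof.
apply/sup_dist_leP => x bx; split; first exact: r0_defined.
rewrite r0_eval; move/bandsP: bx => [/andP[h1 h2]|hx].
  have hx : l <= - x <= 1 by apply/andP; split; lra.
  have := close hx; rewrite P_odd Q_even => h.
  rewrite ltr0_sg; last by move: l_gt0; lra.
  by rewrite -normrN opprD opprK -mulNr.
by rewrite gtr0_sg ?close //; move: l_gt0 hx => ? /andP[]; lra.
Qed.

(** The inverted solution of the dichotomy cannot vanish at 0: evaluating there
    gives q(0) = 0 together with p(0) = 0, against coprimality. *)
Lemma minimax_sign_spec :
  let r := minimax_sign M l in coprimep r.1 r.2 /\ P * r.2 = r.1 * Q.
Proof.
have best0 : best_sign_approx M l r0.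
  split=> // -[p q] [/= sp sq _ _].
  apply: (le_trans r0_dist); rewrite leNgt; apply/negP => lte.
  have /sup_dist_leP h := ltW lte.
  have [||x bx hx] := @close_attains p q sp sq.
  - by move=> x /h[].
  - by move=> x bx; have [_ hx] := h x bx; exact: hx.
  move: lte; apply/negP; rewrite -leNgt.
  apply: (@le_trans _ _ `|p.[x] / q.[x] - Num.sg x|%:E); first by rewrite lee_fin.
  apply: ereal_sup_ubound; exists x => //.
  by have [-> _] := h x bx.
have root0 : root r0.1 0.
  have : P.[0] = 0 by apply/eqP; have := P_odd 0; rewrite oppr0; lra.
  rewrite gP hornerM => /eqP; rewrite mulf_eq0 => /orP[//|g0].
  have := Q_gt0 0; rewrite gQ hornerM (eqP g0) mulr0 ltxx //.
rewrite /minimax_sign; case: xgetP => [[p q] _ [[[/= sp sq q0 cop] best] r0p]|]; last first.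
  by move=> /(_ r0) [].
split=> //.
have /sup_dist_leP h := le_trans (best r0 r0_type) r0_dist.
have [||//|] := @close_dichotomy p q sp sq.
- by move=> x /h[].
- by move=> x bx; have [_ hx] := h x bx; exact: hx.
move/(congr1 (fun f : {poly R} => f.[0])); rewrite !hornerM hornerZ.
rewrite (eqP r0p) mulr0 => /esym/eqP; rewrite !mulf_eq0 (gt_eqF (Q_gt0 0)) orbF.
rewrite gt_eqF ?subr_gt0 ?exprn_ilt1 ?(ltW e_gt0) //= => rq.
have := coprimep_root cop r0p; rewrite (eqP rq) eqxx //.
Qed.

End Minimax.

(** * The elliptic integral and the amplitude *)

Section EllipticIntegral.
Variables (R : realType) (k : R).
Hypothesis k_itv : 0 <= k < 1.
Implicit Types (x y t u v : R).
Local Notation mu := (@lebesgue_measure R).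

Let Delta t := 1 - k ^+ 2 * sin t ^+ 2.
Let w t := (Num.sqrt (Delta t))^-1.

Lemma ksin2_lt1 t : k ^+ 2 * sin t ^+ 2 < 1.
Proof.
have /andP[k0 k1] := k_itv.
apply: (@le_lt_trans _ _ (k ^+ 2)); last by rewrite expr_lt1.
rewrite ler_piMr ?sqr_ge0 // sin2cos2 gerBl sqr_ge0 //.
Qed.

Let Delta_gt0 t : 0 < Delta t.
Proof. by rewrite /Delta subr_gt0 ksin2_lt1. Qed.

Let w_gt0 t : 0 < w t.
Proof. by rewrite /w invr_gt0 sqrtr_gt0. Qed.

Let w_ge1 t : 1 <= w t.
Proof.
rewrite /w invf_ge1 ?sqrtr_gt0 // -sqrtr1 ler_wsqrtr // /Delta gerBl.
by rewrite mulr_ge0 ?sqr_ge0.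
Qed.

Let wN t : w (- t) = w t.
Proof. by rewrite /w /Delta sinN sqrrN. Qed.

Let wDpi t : w (t + pi) = w t.
Proof. by rewrite /w /Delta sinDpi sqrrN. Qed.

Let w_cont : continuous (w : R -> R).
Proof.
move=> t.
have DE : Delta = cst 1 - (cst (k ^+ 2) \* ((fun y : R => y ^+ 2) \o sin)).
  by apply/funext.
have Dc : {for t, continuous Delta}.
  rewrite DE; apply: (@continuousB R R^o R); first exact: cst_continuous.
  apply: (@continuousM R R); first exact: cst_continuous.
  by apply: continuous_comp; [exact: continuous_sin|exact: exprn_continuous].
apply: (@continuousV R R (Num.sqrt \o Delta)).
  by rewrite /= sqrtr_eq0 -ltNge Delta_gt0.
by apply: continuous_comp; [exact: Dc|exact: sqrt_continuous].
Qed.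

Let w_integrable (a b : R) : mu.-integrable `[a, b] (EFin \o w).
Proof.
apply: continuous_compact_integrable; first exact: segment_compact.
by apply: continuous_subspaceT => x; exact: w_cont.
Qed.

Lemma ellF0 : ellF k 0 = 0.
Proof. by rewrite /ellF sgr0 mul0r. Qed.

Lemma ellFN x : ellF k (- x) = - ellF k x.
Proof. by rewrite /ellF sgrN normrN mulNr. Qed.

(** Integration from -B instead of 0 gives a function to which the fundamental
    theorem of calculus applies on both sides of 0, where ellF is defined by
    gluing two halves. *)
Let H B y : R := (\int[mu]_(t in `[- B, y]) w t)%R.

(** Evenness of the integrand matches the odd extension of ellF. *)
Let Rint_opp (y : R) : 0 <= y ->
  (\int[mu]_(t in `[- y, 0]) w t)%R = (\int[mu]_(t in `[0, y]) w t)%R.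
Proof.
move=> y0; rewrite /Rintegral -[in LHS]oppr0.
rewrite integration_by_substitution_oppr //; last first.
  by apply: continuous_subspaceT => x; exact: w_cont.
by congr fine; apply: eq_integral => x _; rewrite /= wN.
Qed.

Let Rint_split (a x b : R) : a <= x -> x <= b ->
  (\int[mu]_(t in `[a, b]) w t - \int[mu]_(t in `[a, x]) w t =
   \int[mu]_(t in `[x, b]) w t)%R.
Proof.
move=> ax xb; rewrite Rintegral_itvB ?bnd_simp //.
rewrite Rintegral_itv_obnd_cbnd //.
by apply: integrableS (w_integrable x b) => //; exact: subset_itv_oc_cc.
Qed.

Let ellF_H (B x : R) : `|x| < B -> ellF k x = H B x - H B 0.
Proof.
move=> xB; have B0 : 0 < B by exact: le_lt_trans xB.
move: (xB); rewrite ltr_norml => /andP[x1 x2]; rewrite /ellF /H.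
have [x0|x0] := leP 0 x.
  rewrite (ger0_norm x0) Rint_split ?oppr_le0 ?(ltW B0) //.
  move: x0; rewrite le_eqVlt => /predU1P[<-|x0]; last by rewrite gtr0_sg ?mul1r.
  by rewrite sgr0 mul0r set_itv1 Rintegral_set1.
rewrite (ltr0_norm x0) ltr0_sg // mulN1r -Rint_opp ?oppr_ge0 ?(ltW x0) // opprK.
by rewrite -(@Rint_split (- B) x 0) ?(ltW x0) ?(ltW x1) // opprB.
Qed.

Lemma is_derive_ellF x :
  is_derive x 1 (ellF k) (Num.sqrt (1 - k ^+ 2 * sin x ^+ 2))^-1.
Proof.
pose B := `|x| + 1.
have xB : `|x| < B by rewrite ltrDl.
have : \forall y \near x, H B y - H B 0 = ellF k y.
  have nB : \forall y \near x, `|y| < B.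
    by apply: (@cvgr_lt _ _ _ _ _ `|x| (@norm_continuous _ R^o x)).
  by apply: filterS nB => y yB; rewrite (ellF_H yB).
move=> nE; apply: (near_eq_is_derive nE).
have [dH HE] : derivable (H B) x 1 /\ derive1 (H B) x = w x.
  move: (xB); rewrite ltr_norml => /andP[x1 x2].
  apply: (@continuous_FTC1_closed R w (- B) x B) => //.
  exact: w_cont.
have dHx : is_derive x 1 (H B) (w x).
  by rewrite -HE derive1E; exact/derivableP.
rewrite -[X in is_derive _ _ _ X]subr0.
by apply: is_deriveB.
Qed.

Let ellF_cont : continuous (ellF k).
Proof.
move=> x; apply: differentiable_continuous; apply/derivable1_diffP.
by have [] := is_derive_ellF x.
Qed.

(** The integrand is at least 1; this gives both strict growth and surjectivity. *)
Lemma ellF_growth x y : x <= y -> y - x <= ellF k y - ellF k x.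
Proof.
rewrite le_eqVlt => /predU1P[->|xy]; first by rewrite !subrr.
have [||c _ ->] := @MVT R (ellF k) w x y xy.
- by move=> z _; exact: is_derive_ellF.
- by apply: continuous_subspaceT => z; exact: ellF_cont.
by rewrite ler_peMl ?subr_ge0 ?(ltW xy).
Qed.

Lemma ellF_inc x y : x < y -> ellF k x < ellF k y.
Proof.
move=> xy; rewrite -subr_gt0; apply: lt_le_trans (ellF_growth (ltW xy)).
by rewrite subr_gt0.
Qed.

Lemma ellF_inj : injective (ellF k).
Proof.
move=> x y e; apply/eqP; rewrite eq_le !leNgt; apply/andP; split; apply/negP.
  by move=> /ellF_inc; rewrite e ltxx.
by move=> /ellF_inc; rewrite e ltxx.
Qed.

Lemma ellF_surj u : exists x, ellF k x = u.
Proof.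
have n0 : - `|u| <= `|u| by rewrite (@le_trans _ _ 0) ?oppr_le0.
have h0 : `|u| <= ellF k `|u|.
  by have := ellF_growth (normr_ge0 u); rewrite ellF0 !subr0.
have [||x _ <-] := @IVT R (ellF k) (- `|u|) `|u| u n0.
- by apply: continuous_subspaceT => z; exact: ellF_cont.
- have fle : ellF k (- `|u|) <= ellF k `|u|.
    by rewrite ellFN (@le_trans _ _ 0) // ?oppr_le0 (le_trans _ h0).
  rewrite (min_idPl fle) (max_idPr fle) ellFN.
  have /andP[u1 u2] : - `|u| <= u <= `|u| by rewrite -ler_norml.
  apply/andP; split; lra.
by exists x.
Qed.

Lemma jacobi_amK u : ellF k (jacobi_am u k) = u.
Proof.
rewrite /jacobi_am; case: xgetP => [//|] hu.
by have [x xu] := ellF_surj u; case: (hu x).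
Qed.

Lemma ellFK x : jacobi_am (ellF k x) k = x.
Proof. by apply: ellF_inj; rewrite jacobi_amK. Qed.

Lemma am0 : jacobi_am 0 k = 0.
Proof. by rewrite -[in LHS]ellF0 ellFK. Qed.

Lemma amN u : jacobi_am (- u) k = - jacobi_am u k.
Proof. by apply: ellF_inj; rewrite ellFN !jacobi_amK. Qed.

Lemma am_inc u v : u < v -> jacobi_am u k < jacobi_am v k.
Proof.
move=> uv; rewrite ltNge le_eqVlt; apply/negP => /predU1P[e|/ellF_inc].
  by move: uv; rewrite -(jacobi_amK u) -e jacobi_amK ltxx.
by rewrite !jacobi_amK => /(lt_trans uv); rewrite ltxx.
Qed.

Lemma am_ellK : jacobi_am (ellK k) k = pi / 2.
Proof. by rewrite /ellK ellFK. Qed.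

Lemma ellK_gt0 : 0 < ellK k.
Proof. by rewrite -ellF0 /ellK ellF_inc // divr_gt0 ?pi_gt0. Qed.

(** The integrand has period pi; evaluation at - pi / 2 identifies the constant. *)
Let ellFDpi_cst x : ellF k (x + pi) - ellF k x = 2 * ellK k.
Proof.
have cst x' y' : ellF k (x' + pi) - ellF k x' = ellF k (y' + pi) - ellF k y'.
  apply: (@is_derive_0_is_cst _ (fun x => ellF k (x + pi) - ellF k x)) => z.
  have d1 : is_derive z 1 (fun x => ellF k (x + pi)) (w z).
    have dz : is_derive z 1 (fun x : R => x + pi) 1.
      by rewrite -[X in is_derive _ _ _ X]addr0; apply: is_deriveD.
    have := @is_derive1_comp _ (ellF k) (fun x => x + pi) z (w (z + pi)) 1
      (is_derive_ellF _) dz.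
    by rewrite mulr1 wDpi.
  rewrite -[X in is_derive _ _ _ X](subrr (w z)).
  by apply: is_deriveB; exact: is_derive_ellF.
rewrite (cst x (- (pi / 2))) ellFN opprK /ellK.
have -> : - (pi / 2) + pi = pi / 2 :> R by lra.
by ring.
Qed.

Lemma amD2K u : jacobi_am (u + 2 * ellK k) k = jacobi_am u k + pi.
Proof.
apply: ellF_inj; rewrite jacobi_amK -{1}(jacobi_amK u).
by rewrite -(ellFDpi_cst (jacobi_am u k)); ring.
Qed.

Lemma dn_gt0 u : 0 < jacobi_dn u k.
Proof. by rewrite /jacobi_dn sqrtr_gt0 subr_gt0 /jacobi_sn ksin2_lt1. Qed.

Lemma is_derive_am u : is_derive u 1 (fun u => jacobi_am u k) (jacobi_dn u k).
Proof.
rewrite -{1}[u]jacobi_amK -[X in is_derive _ _ _ X]invrK.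
apply: (@is_derive_inverse R (ellF k)).
- by near=> z; exact: ellFK.
- by near=> z; exact: ellF_cont.
- exact: is_derive_ellF.
- by rewrite gt_eqF // invr_gt0 dn_gt0.
Unshelve. all: by end_near. Qed.

End EllipticIntegral.

(** * Jacobi functions and their addition theorems *)

Section RealDerivatives.
Variable R : realType.
Implicit Types (f g : R -> R) (x a b : R).

Lemma is_derive_mul f g x a b : is_derive x 1 f a -> is_derive x 1 g b ->
  is_derive x 1 (fun y => f y * g y) (a * g x + f x * b).
Proof.
move=> df dg; have := is_deriveM df dg.
by rewrite /GRing.scale /= addrC [g x * a]mulrC.
Qed.

Lemma is_derive_add f g x a b : is_derive x 1 f a -> is_derive x 1 g b ->
  is_derive x 1 (fun y => f y + g y) (a + b).
Proof. by move=> df dg; apply: is_deriveD. Qed.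

Lemma is_derive_opp f x a : is_derive x 1 f a -> is_derive x 1 (fun y => - f y) (- a).
Proof. by move=> df; apply: is_deriveN. Qed.

Lemma is_derive_reflect f (c x a : R) : is_derive (c - x) 1 f a ->
  is_derive x 1 (fun y => f (c - y)) (- a).
Proof.
move=> df; rewrite -mulrN1; apply: (@is_derive1_comp _ f (fun y => c - y)) => //.
by rewrite -[X in is_derive _ _ _ X]add0r; apply: is_deriveB.
Qed.

(** The form in which the addition theorems are proved: n and d are the
    derivatives of N and D, and n D = N d means that N / D is stationary. *)
Lemma quotient_cst (N D n d : R -> R) :
  (forall x, is_derive x 1 N (n x)) -> (forall x, is_derive x 1 D (d x)) ->
  (forall x, D x != 0) -> (forall x, n x * D x = N x * d x) ->
  forall x y, N x / D x = N y / D y.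
Proof.
move=> dN dD D0 nd x y; apply: (@is_derive_0_is_cst _ (fun x => N x / D x)) => z.
have dV := is_deriveV (D0 z) (dD z).
have := is_derive_mul (dN z) dV; rewrite /GRing.scale /=.
suff -> : n z / D z + N z * (- (D z) ^- 2 * d z) = 0 by [].
have -> : n z / D z = n z * D z / (D z ^+ 2) by field.
by rewrite nd; field.
Qed.

End RealDerivatives.

Section Jacobi.
Variables (R : realType) (k : R).
Hypothesis k_itv : 0 <= k < 1.
Implicit Types (u v c : R).
Local Notation am u := (jacobi_am u k).
Local Notation sn u := (jacobi_sn u k).
Local Notation cn u := (jacobi_cn u k).
Local Notation dn u := (jacobi_dn u k).
Local Notation K := (ellK k).

Lemma cn2 u : cn u ^+ 2 = 1 - sn u ^+ 2.
Proof. by rewrite /jacobi_cn cos2sin2. Qed.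

Lemma dn2 u : dn u ^+ 2 = 1 - k ^+ 2 * sn u ^+ 2.
Proof. by rewrite /jacobi_dn sqr_sqrtr // subr_ge0 ltW // ksin2_lt1. Qed.

Lemma sn0 : sn 0 = 0. Proof. by rewrite /jacobi_sn am0 // sin0. Qed.
Lemma cn0 : cn 0 = 1. Proof. by rewrite /jacobi_cn am0 // cos0. Qed.
Lemma dn0 : dn 0 = 1.
Proof. by rewrite /jacobi_dn sn0 expr0n mulr0 subr0 sqrtr1. Qed.

Lemma snN u : sn (- u) = - sn u. Proof. by rewrite /jacobi_sn amN // sinN. Qed.
Lemma cnN u : cn (- u) = cn u. Proof. by rewrite /jacobi_cn amN // cosN. Qed.
Lemma dnN u : dn (- u) = dn u. Proof. by rewrite /jacobi_dn snN sqrrN. Qed.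

Lemma snD2K u : sn (u + 2 * K) = - sn u.
Proof. by rewrite /jacobi_sn amD2K // sinDpi. Qed.
Lemma dnD2K u : dn (u + 2 * K) = dn u.
Proof. by rewrite /jacobi_dn snD2K sqrrN. Qed.

Lemma snK : sn K = 1. Proof. by rewrite /jacobi_sn am_ellK // sin_pihalf. Qed.
Lemma cnK : cn K = 0. Proof. by rewrite /jacobi_cn am_ellK // cos_pihalf. Qed.
Lemma dnK : dn K = Num.sqrt (1 - k ^+ 2).
Proof. by rewrite /jacobi_dn snK expr1n mulr1. Qed.

Lemma am_itv u : 0 < u < K -> 0 < am u < pi / 2.
Proof.
move=> /andP[u0 uK]; apply/andP; split.
  by rewrite -{1}(am0 k_itv) am_inc.
by rewrite -(am_ellK k_itv) am_inc.
Qed.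

Lemma sn_gt0 u : 0 < u < K -> 0 < sn u.
Proof. by move=> /am_itv h; rewrite /jacobi_sn sin_gt0_pihalf. Qed.

Lemma cn_gt0 u : 0 < u < K -> 0 < cn u.
Proof.
move=> /am_itv /andP[h1 h2]; rewrite /jacobi_cn cos_gt0_pihalf // h2 andbT.
by rewrite (lt_trans _ h1) // oppr_lt0 divr_gt0 ?pi_gt0.
Qed.

(** The case k = 0, where dn is constant, has to be excluded. *)
Lemma dn_dec u v : 0 < k -> 0 <= u -> u < v -> v <= K -> dn v < dn u.
Proof.
move=> k0 u0 uv vK.
have pi2 : 0 < pi / 2 :> R by rewrite divr_gt0 ?pi_gt0.
have h1 : 0 <= am u.
  move: u0; rewrite le_eqVlt => /predU1P[<-|u0]; first by rewrite am0.
  by rewrite -{1}(am0 k_itv) ltW // am_inc.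
have h2 : am u < am v by rewrite am_inc.
have h3 : am v <= pi / 2.
  move: vK; rewrite le_eqVlt => /predU1P[->|vK]; first by rewrite am_ellK.
  by rewrite -(am_ellK k_itv) ltW // am_inc.
have s1 : sn u < sn v.
  by rewrite /jacobi_sn ltr_sin // in_itv /=; apply/andP; split; lra.
have s0 : 0 <= sn u by rewrite /jacobi_sn sin_ge0_pi //; apply/andP; split; lra.
rewrite -(@ltr_pXn2r _ 2) ?nnegrE ?(ltW (dn_gt0 _ _)) // !dn2.
rewrite ltrD2l ltrN2 ltr_pM2l ?exprn_gt0 // ltr_pXn2r ?nnegrE //.
exact: le_trans (ltW s1).
Qed.

Lemma is_derive_sn u : is_derive u 1 (fun u => sn u) (cn u * dn u).
Proof. exact: is_derive1_comp (is_derive_sin _) (is_derive_am k_itv u). Qed.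

Lemma is_derive_cn u : is_derive u 1 (fun u => cn u) (- sn u * dn u).
Proof. exact: is_derive1_comp (is_derive_cos _) (is_derive_am k_itv u). Qed.

Lemma is_derive_dn u : is_derive u 1 (fun u => dn u) (- k ^+ 2 * sn u * cn u).
Proof.
have dD : is_derive u 1 (fun u => 1 - k ^+ 2 * (sn u * sn u))
    (0 + - (0 * (sn u * sn u) + k ^+ 2 * (cn u * dn u * sn u + sn u * (cn u * dn u)))).
  apply: is_derive_add; apply: is_derive_opp; apply: is_derive_mul.
  by apply: is_derive_mul; exact: is_derive_sn.
have D0 : 0 < 1 - k ^+ 2 * (sn u * sn u) by rewrite subr_gt0 -expr2 ksin2_lt1.
have := is_derive1_comp (f := Num.sqrt)
  (g := fun u => 1 - k ^+ 2 * (sn u * sn u)) (is_derive1_sqrt D0) dD.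
have -> : Num.sqrt \o (fun u => 1 - k ^+ 2 * (sn u * sn u)) = (fun u => dn u).
  by apply/funext => x; rewrite /= /jacobi_dn expr2.
rewrite -expr2 -/(jacobi_dn u k).
set y := (X in is_derive _ _ _ X -> _); set z := (X in _ -> is_derive _ _ _ X).
suff -> : y = z by [].
by rewrite /y /z; field; rewrite gt_eqF // dn_gt0.
Qed.

Let is_derive_snr (c x : R) :
  is_derive x 1 (fun y => sn (c - y)) (- (cn (c - x) * dn (c - x))).
Proof. exact: (is_derive_reflect (f := fun u => sn u) (is_derive_sn _)). Qed.

Let is_derive_cnr (c x : R) :
  is_derive x 1 (fun y => cn (c - y)) (- (- sn (c - x) * dn (c - x))).
Proof. exact: (is_derive_reflect (f := fun u => cn u) (is_derive_cn _)). Qed.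

Let is_derive_dnr (c x : R) :
  is_derive x 1 (fun y => dn (c - y)) (- (- k ^+ 2 * sn (c - x) * cn (c - x))).
Proof. exact: (is_derive_reflect (f := fun u => dn u) (is_derive_dn _)). Qed.

Let den_gt0 u v : 0 < 1 - k ^+ 2 * (sn u ^+ 2 * sn v ^+ 2).
Proof.
have sv : sn v ^+ 2 <= 1 by rewrite -subr_ge0 -cn2 sqr_ge0.
have su := ksin2_lt1 k_itv (am u).
rewrite subr_gt0 mulrA; apply: le_lt_trans su.
by rewrite ler_piMr // mulr_ge0 ?sqr_ge0.
Qed.

Let den (c x : R) : R := 1 - k ^+ 2 * (sn x * sn x * (sn (c - x) * sn (c - x))).
Let den' (c x : R) : R := 0 + - (0 * (sn x * sn x * (sn (c - x) * sn (c - x))) + k ^+ 2 *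
  ((cn x * dn x * sn x + sn x * (cn x * dn x)) * (sn (c - x) * sn (c - x)) +
   (sn x * sn x) * ((- (cn (c - x) * dn (c - x))) * sn (c - x)
      + sn (c - x) * (- (cn (c - x) * dn (c - x)))))).

Let is_derive_den (c x : R) : is_derive x 1 (den c) (den' c x).
Proof.
rewrite /den /den'; apply: is_derive_add; apply: is_derive_opp; apply: is_derive_mul.
apply: is_derive_mul; apply: is_derive_mul; first [exact: is_derive_sn|exact: is_derive_snr].
Qed.

Let den_neq0 (c x : R) : den c x != 0.
Proof. by rewrite /den -!expr2 gt_eqF. Qed.

(** Euler's argument: with u + v = c held fixed, the right-hand side is a function
    of u whose derivative vanishes identically by the differential equations of
    sn, cn and dn; at u = 0 it is sn c. *)
Lemma snD u v : sn (u + v) =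
  (sn u * (cn v * dn v) + sn v * (cn u * dn u)) / (1 - k ^+ 2 * (sn u ^+ 2 * sn v ^+ 2)).
Proof.
pose c := u + v.
pose N (x : R) := sn x * (cn (c - x) * dn (c - x)) + sn (c - x) * (cn x * dn x).
have vE : v = c - u by rewrite /c addrC addKr.
have -> : (sn u * (cn v * dn v) + sn v * (cn u * dn u)) /
    (1 - k ^+ 2 * (sn u ^+ 2 * sn v ^+ 2)) = N u / den c u.
  by rewrite /N /den -vE !expr2.
have -> : sn (u + v) = N 0 / den c 0.
  by rewrite /N /den subr0 sn0 cn0 dn0 -/c !(mul0r, mulr0, mulr1, subr0, add0r, divr1).
apply: (quotient_cst (n := fun x =>
   (cn x * dn x * (cn (c - x) * dn (c - x)) +
    sn x * (- (- sn (c - x) * dn (c - x)) * dn (c - x) +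
            cn (c - x) * (- (- k ^+ 2 * sn (c - x) * cn (c - x))))) +
   (- (cn (c - x) * dn (c - x)) * (cn x * dn x) +
    sn (c - x) * (- sn x * dn x * dn x + cn x * (- k ^+ 2 * sn x * cn x))))
   _ (is_derive_den c) (den_neq0 c)).
  move=> x; apply: is_derive_add; apply: is_derive_mul.
  - exact: is_derive_sn.
  - by apply: is_derive_mul; [exact: is_derive_cnr|exact: is_derive_dnr].
  - exact: is_derive_snr.
  - by apply: is_derive_mul; [exact: is_derive_cn|exact: is_derive_dn].
move=> x; rewrite /N /den /den'.
have := cn2 x; have := dn2 x; have := cn2 (c - x); have := dn2 (c - x).
move: (sn x) (cn x) (dn x) (sn (c - x)) (cn (c - x)) (dn (c - x)).
move=> s1 c1 d1 s2 c2 d2 hd2 hc2 hd1 hc1.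
ring: hd2 hc2 hd1 hc1.
Qed.

Lemma dnD u v : dn (u + v) =
  (dn u * dn v - k ^+ 2 * ((sn u * cn u) * (sn v * cn v))) /
    (1 - k ^+ 2 * (sn u ^+ 2 * sn v ^+ 2)).
Proof.
pose c := u + v.
pose N (x : R) := dn x * dn (c - x) - k ^+ 2 * ((sn x * cn x) * (sn (c - x) * cn (c - x))).
have vE : v = c - u by rewrite /c addrC addKr.
have -> : (dn u * dn v - k ^+ 2 * ((sn u * cn u) * (sn v * cn v))) /
    (1 - k ^+ 2 * (sn u ^+ 2 * sn v ^+ 2)) = N u / den c u.
  by rewrite /N /den -vE !expr2.
have -> : dn (u + v) = N 0 / den c 0.
  by rewrite /N /den subr0 sn0 dn0 -/c !(mul0r, mulr0, mul1r, subr0, add0r, divr1).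
apply: (quotient_cst (n := fun x =>
   ((- k ^+ 2 * sn x * cn x) * dn (c - x) +
    dn x * (- (- k ^+ 2 * sn (c - x) * cn (c - x)))) +
   - (0 * ((sn x * cn x) * (sn (c - x) * cn (c - x))) + k ^+ 2 *
     ((cn x * dn x * cn x + sn x * (- sn x * dn x)) * (sn (c - x) * cn (c - x)) +
      (sn x * cn x) *
      (- (cn (c - x) * dn (c - x)) * cn (c - x) +
       sn (c - x) * (- (- sn (c - x) * dn (c - x)))))))
   _ (is_derive_den c) (den_neq0 c)).
  move=> x; apply: is_derive_add; last apply: is_derive_opp; apply: is_derive_mul.
  - exact: is_derive_dn.
  - exact: is_derive_dnr.
  - apply: is_derive_mul; apply: is_derive_mul.
    + exact: is_derive_sn.
    + exact: is_derive_cn.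
    + exact: is_derive_snr.
    + exact: is_derive_cnr.
move=> x; rewrite /N /den /den'.
have := cn2 x; have := dn2 x; have := cn2 (c - x); have := dn2 (c - x).
move: (sn x) (cn x) (dn x) (sn (c - x)) (cn (c - x)) (dn (c - x)).
move=> s1 c1 d1 s2 c2 d2 hd2 hc2 hd1 hc1.
ring: hd2 hc2 hd1 hc1.
Qed.

End Jacobi.

(** * Rational maps of the unit circle *)

Section UnitCircle.
Variable R : realType.
Implicit Types (a : nat -> R) (n : nat) (x y : R) (z : R[i]).

(** On the circle z = x + iy, multiplying z by all (z^2 + a_j)(1 + a_j conj(z)^2)
    gives x p(x^2) + i y q(x^2).  The recursion computes (p, q): one more factor
    is A(x^2) + i x y B with A and B as below, and y^2 is replaced by 1 - x^2. *)
Fixpoint re_im_num a n : {poly R} * {poly R} :=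
  if n is m.+1 then
    let: (p, q) := re_im_num a m in
    let A := (2 * (1 + a n ^+ 2)) *: 'X - ((1 - a n) ^+ 2)%:P in
    let B := (2 * (1 - a n ^+ 2))%:P in
    (p * A - (1 - 'X) * q * B, 'X * p * B + q * A)
  else (1, 1).

(** The product of the |1 + a_j z^2|^2 as a polynomial in x^2. *)
Definition sq_den a n : {poly R} :=
  \prod_(1 <= j < n.+1) (((1 - a j) ^+ 2)%:P + (4 * a j) *: 'X).

(** The function r_{2n+1} with arbitrary coefficients. *)
Definition circle_map a n z : R[i] :=
  z * \prod_(1 <= j < n.+1) ((z ^+ 2 + (a j)%:C) / (1 + (a j)%:C * z ^+ 2)).

Lemma size_re_im_num a n :
  (size (re_im_num a n).1 <= n.+1)%N /\ (size (re_im_num a n).2 <= n.+1)%N.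
Proof.
elim: n => [|n] /=; first by rewrite size_poly1.
case: (re_im_num a n) => p q /= [sp sq].
set A := _ *: 'X - _; set B := _%:P.
have sA : (size A <= 2)%N.
  rewrite (leq_trans (size_polyD _ _)) // geq_max size_polyN.
  rewrite (leq_trans (size_scale_leq _ _)) ?size_polyX //=.
  by rewrite (leq_trans (size_polyC_leq1 _)).
have sB : (size B <= 1)%N by exact: size_polyC_leq1.
have s1 : (size (1 - 'X : {poly R})%R <= 2)%N.
  by rewrite (leq_trans (size_polyD _ _)) // geq_max size_polyN size_poly1 size_polyX.
have sX : (size ('X : {poly R}) <= 2)%N by rewrite size_polyX.
have mul (f g : {poly R}) i j : (size f <= i.+1)%N -> (size g <= j.+1)%N ->
    (size (f * g)%R <= (i + j).+1)%N.
  move=> hf hg; apply: (leq_trans (size_polyMleq _ _)).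
  by move: (size f) (size g) hf hg => sf sg hf hg; lia.
have add (f g : {poly R}) i : (size f <= i)%N -> (size g <= i)%N ->
    (size (f + g)%R <= i)%N.
  by move=> hf hg; rewrite (leq_trans (size_polyD _ _)) // geq_max hf hg.
split; apply: add.
- by have := mul _ _ _ _ sp sA; rewrite addn1.
- by rewrite size_polyN; have := mul _ _ _ _ (mul _ _ _ _ s1 sq) sB; rewrite addn0 add1n.
- by have := mul _ _ _ _ (mul _ _ _ _ sX sp) sB; rewrite addn0 add1n.
- by have := mul _ _ _ _ sq sA; rewrite addn1.
Qed.

Lemma size_sq_den a n : (size (sq_den a n) <= n.+1)%N.
Proof.
elim: n => [|n IHn]; first by rewrite /sq_den big_nil size_poly1.
rewrite /sq_den big_nat_recr //= -/(sq_den a n).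
apply: (leq_trans (size_polyMleq _ _)).
set f := _ + _; have sf : (size f <= 2)%N.
  rewrite (leq_trans (size_polyD _ _)) // geq_max (leq_trans (size_polyC_leq1 _)) //.
  by rewrite (leq_trans (size_scale_leq _ _)) // size_polyX.
by move: (size _) (size _) IHn sf => s1 s2; lia.
Qed.

Lemma sq_denE a n y :
  (sq_den a n).[y] = \prod_(1 <= j < n.+1) ((1 - a j) ^+ 2 + 4 * a j * y).
Proof.
rewrite /sq_den horner_prod; apply: eq_bigr => j _.
by rewrite hornerD hornerC hornerZ hornerX.
Qed.

Lemma circle_y2 x y : x ^+ 2 + y ^+ 2 = 1 -> y ^+ 2 = 1 - x ^+ 2.
Proof. by move=> <-; rewrite addrC addKr. Qed.

Lemma circle_numE a n x y : x ^+ 2 + y ^+ 2 = 1 ->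
  (x +i* y) * \prod_(1 <= j < n.+1)
    (((x +i* y) ^+ 2 + (a j)%:C) * (1 + (a j)%:C * (x -i* y) ^+ 2)) =
  (x * (re_im_num a n).1.[x ^+ 2]) +i* (y * (re_im_num a n).2.[x ^+ 2]).
Proof.
move=> xy; elim: n => [|n IHn]; first by rewrite big_nil /= !hornerC !mulr1.
rewrite big_nat_recr //= mulrA {}IHn.
case: (re_im_num a n) => p q /=.
rewrite !(hornerD, hornerN, hornerM, hornerZ, hornerC, hornerX).
move: p.[_] q.[_] (a n.+1) => p0 q0 b.
apply/eqP; rewrite eq_complex /=; apply/andP; split; apply/eqP; ring: (circle_y2 xy).
Qed.

Lemma circle_denE (b x y : R) : x ^+ 2 + y ^+ 2 = 1 ->
  (1 + b%:C * (x +i* y) ^+ 2) * (1 + b%:C * (x -i* y) ^+ 2) =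
  ((1 - b) ^+ 2 + 4 * b * x ^+ 2)%:C.
Proof.
move=> xy.
by apply/eqP; rewrite eq_complex /=; apply/andP; split; apply/eqP; ring: (circle_y2 xy).
Qed.

Lemma circle_den_gt0 (b x : R) : 0 < b -> b != 1 -> 0 < (1 - b) ^+ 2 + 4 * b * x ^+ 2.
Proof.
move=> b0 b1; apply: ltr_pwDl; last by rewrite mulr_ge0 ?sqr_ge0 ?mulr_ge0 ?ltW.
by rewrite exprn_even_gt0 //= subr_eq0 eq_sym.
Qed.

Lemma circle_den_neq0 (b x y : R) : 0 < b -> b != 1 -> x ^+ 2 + y ^+ 2 = 1 ->
  1 + b%:C * (x +i* y) ^+ 2 != 0.
Proof.
move=> b0 b1 xy; have := circle_denE b xy.
have := circle_den_gt0 x b0 b1 => h; apply: contra_eqN => /eqP ->.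
by rewrite mul0r eq_sym fmorph_eq0 gt_eqF.
Qed.

Lemma circle_num_neq0 (b x y : R) : 0 < b -> b != 1 -> x ^+ 2 + y ^+ 2 = 1 ->
  (x +i* y) ^+ 2 + b%:C != 0.
Proof.
move=> b0 b1 xy.
have bv1 : b^-1 != 1 by rewrite invr_eq1.
have bC0 : b%:C != 0 :> R[i] by rewrite fmorph_eq0 gt_eqF.
have -> : (x +i* y) ^+ 2 + b%:C = b%:C * (1 + (b^-1)%:C * (x +i* y) ^+ 2).
  by rewrite fmorphV mulrDr mulr1 mulrA divff // mul1r addrC.
by rewrite mulf_neq0 // circle_den_neq0 // invr_gt0.
Qed.

Variables (a : nat -> R) (n : nat).
Hypothesis a_gt0 : forall j, (0 < j <= n)%N -> 0 < a j.
Hypothesis a_neq1 : forall j, (0 < j <= n)%N -> a j != 1.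

Lemma sq_den_gt0 x : 0 < (sq_den a n).[x ^+ 2].
Proof.
rewrite sq_denE big_nat; apply: prodr_gt0 => j hj.
by apply: circle_den_gt0; [exact: a_gt0|exact: a_neq1].
Qed.

Lemma circle_mapE x y : x ^+ 2 + y ^+ 2 = 1 ->
  circle_map a n (x +i* y) =
   (x * (re_im_num a n).1.[x ^+ 2] / (sq_den a n).[x ^+ 2]) +i*
   (y * (re_im_num a n).2.[x ^+ 2] / (sq_den a n).[x ^+ 2]).
Proof.
move=> xy; set q := (sq_den a n).[x ^+ 2].
have q0 : q != 0 by rewrite gt_eqF // sq_den_gt0.
transitivity (((x * (re_im_num a n).1.[x ^+ 2]) +i* (y * (re_im_num a n).2.[x ^+ 2]))
   * (q^-1)%:C); last first.
  by apply/eqP; rewrite eq_complex /=; apply/andP; split; apply/eqP; ring.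
rewrite -circle_numE // /circle_map -mulrA; congr (_ * _).
rewrite fmorphV /q sq_denE rmorph_prod /= -prodfV -big_split /=.
apply: eq_big_nat => j hj; rewrite -(circle_denE _ xy).
have h1 := circle_den_neq0 (a_gt0 hj) (a_neq1 hj) xy.
have xy' : x ^+ 2 + (- y) ^+ 2 = 1 by rewrite sqrrN.
have h2 := circle_den_neq0 (a_gt0 hj) (a_neq1 hj) xy'.
by field; rewrite h1 h2.
Qed.

(** On the circle conj z = 1/z, and each factor is inverted by z -> 1/z. *)
Lemma circle_map_conj x y : x ^+ 2 + y ^+ 2 = 1 ->
  circle_map a n (x +i* y) * circle_map a n (x -i* y) = 1.
Proof.
move=> xy; rewrite /circle_map mulrACA -big_split /= big_nat.
have zz : (x +i* y) * (x -i* y) = 1.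
  by apply/eqP; rewrite eq_complex /=; apply/andP; split; apply/eqP; ring: (circle_y2 xy).
rewrite big1 ?mulr1 // => j hj.
have h1 := circle_den_neq0 (a_gt0 hj) (a_neq1 hj) xy.
have xy' : x ^+ 2 + (- y) ^+ 2 = 1 by rewrite sqrrN.
have h2 := circle_den_neq0 (a_gt0 hj) (a_neq1 hj) xy'.
rewrite mulf_div; apply: (canLR (mulfK _)); first exact: mulf_neq0.
move: (x +i* y) (x -i* y) zz => z w zz; ring: zz.
Qed.

Lemma circle_map_unit x y : x ^+ 2 + y ^+ 2 = 1 ->
  let z := circle_map a n (x +i* y) in complex.Re z ^+ 2 + complex.Im z ^+ 2 = 1.
Proof.
move=> xy /=; have := circle_map_conj xy.
have xy' : x ^+ 2 + (- y) ^+ 2 = 1 by rewrite sqrrN.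
rewrite (circle_mapE xy) (circle_mapE xy') => /(congr1 (fun z => complex.Re z)) /= h.
by rewrite -[RHS]h !mulNr mulrN opprK !expr2.
Qed.

Lemma circle_map1 : circle_map a n 1 = 1.
Proof.
rewrite /circle_map big_nat big1 ?mulr1 // => j hj; rewrite expr1n mulr1 divff //.
have x10 : 1 ^+ 2 + 0 ^+ 2 = 1 :> R by rewrite expr0n addr0 expr1n.
have E1 : 1 +i* 0 = 1 :> R[i] by [].
by have := circle_den_neq0 (a_gt0 hj) (a_neq1 hj) x10; rewrite E1 expr1n mulr1.
Qed.

Lemma re_num1 : (re_im_num a n).1.[1] = (sq_den a n).[1].
Proof.
have x10 : 1 ^+ 2 + 0 ^+ 2 = 1 :> R by rewrite expr0n addr0 expr1n.
have E1 : 1 +i* 0 = 1 :> R[i] by [].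
have := circle_mapE x10; rewrite E1 expr1n circle_map1 => /(congr1 (fun z => complex.Re z)) /=.
have := sq_den_gt0 1; rewrite expr1n mul1r => h e.
by apply: (divIf (lt0r_neq0 h)); rewrite -e divff // gt_eqF.
Qed.

End UnitCircle.

(** * The elliptic parametrization of the circle *)

Section Telescoping.
Variables (R : realType) (k : R).
Hypothesis k_itv : 0 <= k < 1.
Implicit Types (u v t : R).
Local Notation sn u := (jacobi_sn u k).
Local Notation cn u := (jacobi_cn u k).
Local Notation dn u := (jacobi_dn u k).
Local Notation K := (ellK k).

(** A point of the unit circle with sine k sn u: as u runs over [-K, K] it sweeps
    the arc |arg z| <= Theta when k = sin Theta. *)
Definition zeta u : R[i] := dn u +i* (k * sn u).

Lemma zeta_circle u : dn u ^+ 2 + (k * sn u) ^+ 2 = 1.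
Proof. by rewrite dn2 // exprMn subrK. Qed.

Lemma zetaD2K u : zeta (u + 2 * K) = dn u -i* (k * sn u).
Proof. by rewrite /zeta dnD2K // snD2K // mulrN. Qed.

Lemma zeta_conj u : zeta u * (dn u -i* (k * sn u)) = 1.
Proof.
apply/eqP; rewrite eq_complex /=; apply/andP; split; apply/eqP.
  by rewrite mulrN opprK -!expr2 zeta_circle.
by ring.
Qed.

Lemma zeta_neq0 u : zeta u != 0.
Proof. by apply: contra_eqN (zeta_conj u) => /eqP ->; rewrite mul0r eq_sym oner_eq0. Qed.

(** It is the square of the tangent of half the amplitude of t. *)
Definition half_ratio t : R := (1 - cn t) / (1 + cn t).

Lemma cn_lt1 t : 0 < t < K -> cn t < 1.
Proof.
move=> ht; have c0 := cn_gt0 k_itv ht; have s0 := sn_gt0 k_itv ht.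
by rewrite -(@ltr_pXn2r _ 2) ?nnegrE ?ltW // expr1n cn2 gtrBl exprn_gt0.
Qed.

Lemma half_ratio_itv t : 0 < t < K -> 0 < half_ratio t < 1.
Proof.
move=> ht; have c0 := cn_gt0 k_itv ht; have c1 := cn_lt1 ht.
rewrite /half_ratio; apply/andP; split; first by rewrite divr_gt0; lra.
rewrite ltr_pdivrMr; lra.
Qed.

(** The reason why elliptic functions enter: by the addition theorems a quadratic
    factor of r at zeta u is the product of two translates of zeta. *)
Lemma zeta_mul u t : 0 < t < K ->
  zeta (u + t) * zeta (u - t) =
  (zeta u ^+ 2 + (half_ratio t)%:C) / (1 + (half_ratio t)%:C * zeta u ^+ 2).
Proof.
move=> ht; have /andP[b0 b1] := half_ratio_itv ht.
have cden : 1 + (half_ratio t)%:C * zeta u ^+ 2 != 0.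
  by apply: circle_den_neq0; rewrite ?lt_eqF // zeta_circle.
apply: (canRL (mulfK cden)).
have c1 : 0 < 1 + cn t by rewrite addr_gt0 ?cn_gt0.
have D0 : 0 < 1 - k ^+ 2 * (sn u ^+ 2 * sn t ^+ 2).
  have sv : sn t ^+ 2 <= 1 by rewrite -subr_ge0 -cn2 sqr_ge0.
  have su := ksin2_lt1 k_itv (jacobi_am u k).
  rewrite subr_gt0 mulrA; apply: le_lt_trans su.
  by rewrite ler_piMr // mulr_ge0 ?sqr_ge0.
rewrite /zeta /half_ratio !snD // !dnD // !snN // !cnN // !dnN // sqrrN.
have := cn2 k u; have := dn2 k_itv u; have := cn2 k t; have := dn2 k_itv t.
move: c1 D0; move: (sn u) (cn u) (dn u) (sn t) (cn t) (dn t).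
move=> s1 c1 d1 s2 c2 d2 c20 D0 hd2 hc2 hd1 hc1.
have nz : (1 + c2 != 0) && (1 - k ^+ 2 * (s1 ^+ 2 * s2 ^+ 2) != 0).
  by rewrite !gt_eqF.
apply/eqP; rewrite eq_complex /=; apply/andP; split; apply/eqP;
  field: hd2 hc2 hd1 hc1; rewrite !exprMn; exact: nz.
Qed.

Definition alt_inv (i : nat) (z : R[i]) : R[i] := if odd i then z^-1 else z.

Lemma alt_invM i z1 z2 : alt_inv i (z1 * z2) = alt_inv i z1 * alt_inv i z2.
Proof. by rewrite /alt_inv; case: ifP => // _; rewrite invfM. Qed.

Lemma alt_invS i z : alt_inv i.+1 z = alt_inv i z^-1.
Proof. by rewrite /alt_inv /=; case: (odd i) => //=; rewrite invrK. Qed.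

(** The factors i and -i of the product of the zeta (u + ih)^((-1)^i), |i| <= m,
    are grouped. *)
Definition alt_prod (h : R) m u : R[i] :=
  zeta u * \prod_(1 <= i < m.+1) alt_inv i (zeta (u + i%:R * h) * zeta (u - i%:R * h)).

(** Shifting by h reverses the parity of the exponents, so that the product with
    the shifted one telescopes to its two extreme terms. *)
Lemma alt_prod_shift h m u :
  alt_prod h m u * alt_prod h m (u + h) =
  alt_inv m (zeta (u + m.+1%:R * h) * zeta (u - m%:R * h)).
Proof.
elim: m => [|m IHm].
  by rewrite /alt_prod !big_nil !mulr1 /alt_inv /= mul1r mul0r subr0 mulrC.
have step v : alt_prod h m.+1 v = alt_prod h m v *
    alt_inv m.+1 (zeta (v + m.+1%:R * h) * zeta (v - m.+1%:R * h)).
  by rewrite /alt_prod big_nat_recr //= mulrA.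
rewrite !step mulrACA IHm -alt_invM !alt_invS -alt_invM; congr alt_inv.
have -> : u + h + m.+1%:R * h = u + m.+2%:R * h.
  by rewrite -[in RHS]natr1; ring.
have -> : u + h - m.+1%:R * h = u - m%:R * h.
  by rewrite -natr1; ring.
by field; rewrite !zeta_neq0.
Qed.

(** For h = 2K / (2n+1) the extreme points differ by 2K, where zeta takes inverse
    values. *)
Lemma alt_prod_anti n u : let h := 2 * K / (2 * n + 1)%:R in
  alt_prod h n u * alt_prod h n (u + h) = 1.
Proof.
move=> h; rewrite alt_prod_shift.
have -> : u + n.+1%:R * h = (u - n%:R * h) + 2 * K.
  have n0 : (2 * n + 1)%:R != 0 :> R by rewrite pnatr_eq0 addn1.
  have -> : 2 * K = (2 * n + 1)%:R * h by rewrite /h [RHS]mulrC divfK.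
  by rewrite natrD natrM -natr1; ring.
by rewrite zetaD2K mulrC zeta_conj /alt_inv invr1 if_same.
Qed.

End Telescoping.

Section Coefficients.
Variables (R : realType) (Theta : R) (n : nat).
Hypothesis Theta_itv : 0 <= Theta < pi / 2.

Lemma sin_Theta_itv : 0 <= sin Theta < 1.
Proof.
have /andP[t0 t1] := Theta_itv; have := pi_gt0 R => p0.
apply/andP; split; first by rewrite sin_ge0_pi //; apply/andP; split; lra.
by rewrite -sin_pihalf ltr_sin // in_itv /=; apply/andP; split; lra.
Qed.

Lemma cos_Theta_gt0 : 0 < cos Theta.
Proof.
have /andP[t0 t1] := Theta_itv; have := pi_gt0 R => p0.
by rewrite cos_gt0_pihalf // t1 andbT; lra.
Qed.

Local Notation k := (sin Theta).
Local Notation K := (ellK k).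
Local Notation h := (2 * K / (2 * n + 1)%:R).

(** The modulus sqrt (1 - l^2) used in the definition of a_j is sin Theta. *)
Lemma comodulus : Num.sqrt (1 - cos Theta ^+ 2) = k.
Proof.
by rewrite -sin2cos2 sqrtr_sqr ger0_norm //; have /andP[] := sin_Theta_itv.
Qed.

(** Shifting the argument by the quarter period K rewrites the quotient that
    defines a_j in terms of cn alone. *)
Lemma quarter_shift t : 0 < t < K ->
  ((cos Theta * jacobi_sn (K - t) k + jacobi_dn (K - t) k) / jacobi_cn (K - t) k) ^+ 2
  = (half_ratio k t)^-1.
Proof.
have k_itv := sin_Theta_itv; have l0 := cos_Theta_gt0 => ht.
have s0 := sn_gt0 k_itv ht; have c0 := cn_gt0 k_itv ht; have d0 := dn_gt0 k_itv t.
have c1 := cn_lt1 k_itv ht.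
have sE : jacobi_sn (K - t) k = jacobi_cn t k / jacobi_dn t k.
  rewrite snD // snK // cnK // snN // cnN // dnN // sqrrN expr1n !mul1r mul0r mulr0 addr0.
  by rewrite -dn2 //; field; rewrite gt_eqF.
have dE : jacobi_dn (K - t) k = cos Theta / jacobi_dn t k.
  rewrite dnD // snK // cnK // snN // cnN // dnN // sqrrN expr1n mulr0 mul0r mulr0 subr0 mul1r.
  rewrite -dn2 // dnK // -cos2sin2 sqrtr_sqr gtr0_norm //.
  by field; rewrite gt_eqF.
rewrite expr_div_n cn2 // sE dE /half_ratio.
have hd := dn2 k_itv t; have hc := cn2 k t; have hk := sin2cos2 Theta.
move: l0 s0 c0 c1 d0 hd hc hk; move: (cos Theta) k => l k0.
move: (jacobi_sn t k0) (jacobi_cn t k0) (jacobi_dn t k0) => s c d l0 s0 c0 c1 d0 hd hc hk.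
have cd : 1 - (c / d) ^+ 2 = (l * s / d) ^+ 2.
  rewrite !expr_div_n; apply: (@mulIf _ (d ^+ 2)); first by rewrite expf_neq0 // gt_eqF.
  rewrite mulrBl !divfK ?expf_neq0 ?gt_eqF // mul1r hd hc exprMn hk; ring.
have sc : s ^+ 2 = 1 - c ^+ 2 by rewrite hc; ring.
rewrite cd; field: sc.
by apply/and5P; split; rewrite gt_eqF //; lra.
Qed.

Lemma step_itv i : (0 < i <= n)%N -> 0 < i%:R * h < K.
Proof.
move=> /andP[i0 ile]; have K0 := ellK_gt0 sin_Theta_itv.
have d0 : 0 < (2 * n + 1)%:R :> R by rewrite ltr0n addn1.
have i0' : 0 < i%:R :> R by rewrite ltr0n.
apply/andP; split; first by rewrite mulr_gt0 // divr_gt0 // mulr_gt0.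
rewrite mulrA ltr_pdivrMr // mulrCA mulrA [ltRHS]mulrC ltr_pM2r // -natrM ltr_nat.
by lia.
Qed.

(** The index is reversed: v_j = K - ih for i = n+1-j, which turns the parity of
    j + n into that of i + 1. *)
Lemma a_coefE i : (0 < i <= n)%N ->
  a_coef n Theta (n.+1 - i) =
  if odd i then (half_ratio k (i%:R * h))^-1 else half_ratio k (i%:R * h).
Proof.
move=> hi; have /andP[i0 ile] := hi; rewrite /a_coef comodulus.
have -> : (2 * (n.+1 - i) - 1)%:R / (2 * n + 1)%:R * ellK k = K - i%:R * h.
  have d0 : (2 * n + 1)%:R != 0 :> R by rewrite pnatr_eq0 addn1.
  have -> : (2 * (n.+1 - i) - 1)%:R = (2 * n + 1)%:R - 2 * i%:R :> R.
    by rewrite -natrM -natrB; [congr _%:R; lia|lia].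
  by field.
have qs := quarter_shift (step_itv hi).
rewrite -[(-1) ^+ (_ + n)]signr_odd.
have -> : odd (n.+1 - i + n) = ~~ odd i.
  have -> : (n.+1 - i + n = n.*2.+1 - i)%N by lia.
  by rewrite oddB; [rewrite /= odd_double addTb|lia].
case: (odd i) => /=.
  by have -> : 2 * (-1) ^+ false = 2 :> int by []; rewrite -qs.
by have -> : 2 * (-1) ^+ true = - 2%:Z :> int by []; rewrite -exprnN qs invrK.
Qed.

Lemma a_coef_gt0 j : (0 < j <= n)%N -> 0 < a_coef n Theta j.
Proof.
move=> hj; have hi : (0 < n.+1 - j <= n)%N by lia.
have -> : j = (n.+1 - (n.+1 - j))%N by lia.
have /andP[b0 b1] := half_ratio_itv sin_Theta_itv (step_itv hi).
by rewrite a_coefE //; case: ifP; rewrite ?invr_gt0.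
Qed.

Lemma a_coef_neq1 j : (0 < j <= n)%N -> a_coef n Theta j != 1.
Proof.
move=> hj; have hi : (0 < n.+1 - j <= n)%N by lia.
have -> : j = (n.+1 - (n.+1 - j))%N by lia.
have /andP[b0 b1] := half_ratio_itv sin_Theta_itv (step_itv hi).
by rewrite a_coefE //; case: ifP; rewrite ?invr_eq1 lt_eqF.
Qed.

(** For odd i the coefficient is 1/b, which inverts the factor, as the exponent
    (-1)^i does in the alternating product. *)
Lemma circle_map_zeta u :
  circle_map (a_coef n Theta) n (zeta k u) = alt_prod k h n u.
Proof.
rewrite /circle_map /alt_prod big_nat_rev /=; congr (_ * _).
apply: eq_big_nat => i hi; have hi' : (0 < i <= n)%N by [].
have -> : (1 + n.+1 - i.+1 = n.+1 - i)%N by lia.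
have k_itv := sin_Theta_itv.
have /andP[b0 b1] := half_ratio_itv k_itv (step_itv hi').
rewrite zeta_mul ?step_itv // a_coefE // /alt_inv; case: ifP => // _.
have bn1 : half_ratio k (i%:R * h) != 1 by rewrite lt_eqF.
have zc := zeta_circle k_itv u.
have h1 := circle_den_neq0 b0 bn1 zc; have h2 := circle_num_neq0 b0 bn1 zc.
have hb : (half_ratio k (i%:R * h))%:C != 0 :> R[i] by rewrite fmorph_eq0 gt_eqF.
have bV : ((half_ratio k (i%:R * h))^-1)%:C = ((half_ratio k (i%:R * h))%:C)^-1 :> R[i].
  exact: fmorphV.
move: h1 h2 hb; rewrite bV -/(zeta k u).
move: (zeta k u) (half_ratio _ _)%:C => z b h1 h2 hb.
by field; rewrite h1 h2 hb.
Qed.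

Lemma circle_map_zeta_shift u :
  circle_map (a_coef n Theta) n (zeta k u) * circle_map (a_coef n Theta) n (zeta k (u + h)) = 1.
Proof. by rewrite !circle_map_zeta alt_prod_anti // sin_Theta_itv. Qed.

Lemma r_odd_evalE z :
  rf_eval (rf_complex (r_odd n Theta)) z = circle_map (a_coef n Theta) n z.
Proof.
rewrite /rf_eval /rf_complex /r_odd /circle_map /=.
rewrite rmorphM /= map_polyX hornerM hornerX -mulrA; congr (_ * _).
rewrite !rmorph_prod !horner_prod /= -prodfV -big_split /=.
apply: eq_bigr => j _; rewrite !rmorphD /= map_polyC map_polyXn rmorph1 /=.
by rewrite map_polyZ map_polyXn !hornerD hornerC hornerZ !hornerXn hornerC.
Qed.

Lemma r_odd_defined x y : x ^+ 2 + y ^+ 2 = 1 ->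
  rf_defined (rf_complex (r_odd n Theta)) (x +i* y).
Proof.
move=> xy; rewrite /rf_defined /rf_complex /r_odd /=.
rewrite rmorph_prod horner_prod /= prodf_seq_neq0.
apply/allP => j; rewrite mem_index_iota => hj.
rewrite !rmorphD /= rmorph1 /= map_polyZ map_polyXn hornerD hornerZ hornerXn hornerC.
by rewrite circle_den_neq0 ?a_coef_gt0 ?a_coef_neq1.
Qed.

End Coefficients.

(** * Equioscillation of the real part *)

Section Numerator.
Variables (R : realType) (Theta : R) (n : nat).

(** The real part of r at exp (it) is cos_num / cos_den evaluated at cos t. *)
Definition cos_num : {poly R} := 'X * ((re_im_num (a_coef n Theta) n).1 \Po 'X^2).
Definition cos_den : {poly R} := sq_den (a_coef n Theta) n \Po 'X^2.

Lemma size_comp_sqr (p : {poly R}) m :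
  (size p <= m.+1)%N -> (size (p \Po 'X^2) <= (2 * m).+1)%N.
Proof.
move=> sp; apply: (leq_trans (size_comp_poly_leq _ _)).
by rewrite size_polyXn /=; move: (size p) sp => s; lia.
Qed.

Lemma size_cos_num : (size cos_num <= (2 * n + 1).+1)%N.
Proof.
apply: (leq_trans (size_polyMleq _ _)); rewrite size_polyX /=.
have := size_comp_sqr (size_re_im_num (a_coef n Theta) n).1.
by move: (size _) => s; lia.
Qed.

Lemma size_cos_den : (size cos_den <= (2 * n + 1).+1)%N.
Proof.
have := size_comp_sqr (size_sq_den (a_coef n Theta) n).
by rewrite -/cos_den; move: (size _) => s; lia.
Qed.

Lemma cos_numE x :
  cos_num.[x] = x * (re_im_num (a_coef n Theta) n).1.[x ^+ 2].
Proof. by rewrite hornerM hornerX horner_comp hornerXn. Qed.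

Lemma cos_denE x : cos_den.[x] = (sq_den (a_coef n Theta) n).[x ^+ 2].
Proof. by rewrite horner_comp hornerXn. Qed.

Lemma cos_numN x : cos_num.[- x] = - cos_num.[x].
Proof. by rewrite !cos_numE sqrrN mulNr. Qed.

Lemma cos_denN x : cos_den.[- x] = cos_den.[x].
Proof. by rewrite !cos_denE sqrrN. Qed.

Hypothesis Theta_itv : 0 <= Theta < pi / 2.

Let a_gt0 j : (0 < j <= n)%N -> 0 < a_coef n Theta j.
Proof. exact: a_coef_gt0. Qed.

Let a_neq1 j : (0 < j <= n)%N -> a_coef n Theta j != 1.
Proof. exact: a_coef_neq1. Qed.

Lemma cos_den_gt0 x : 0 < cos_den.[x].
Proof. by rewrite cos_denE; exact: sq_den_gt0. Qed.

Lemma Re_circle_map x y : x ^+ 2 + y ^+ 2 = 1 ->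
  complex.Re (circle_map (a_coef n Theta) n (x +i* y)) = cos_num.[x] / cos_den.[x].
Proof. by move=> xy; rewrite circle_mapE //= cos_numE cos_denE. Qed.

Lemma cos_ratio1 : cos_num.[1] = cos_den.[1].
Proof. by rewrite cos_numE cos_denE expr1n mul1r re_num1. Qed.

Lemma cos_ratio_le1 (x : R) : -1 <= x <= 1 -> cos_num.[x] / cos_den.[x] <= 1.
Proof.
move=> hx; have xy : x ^+ 2 + Num.sqrt (1 - x ^+ 2) ^+ 2 = 1.
  rewrite sqr_sqrtr; first by rewrite addrC subrK.
  by move: hx => /andP[? ?]; rewrite subr_ge0; nra.
have := circle_map_unit a_gt0 a_neq1 xy => /=; rewrite Re_circle_map //.
set s := _ / _; set t := complex.Im _ => st.
have : s ^+ 2 <= 1 by rewrite -st lerDl sqr_ge0.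
by move=> s2; rewrite leNgt; apply/negP => s1; nra.
Qed.

End Numerator.

Lemma half_leq i n : (i < 2 * n + 2)%N -> (i./2 <= n)%N.
Proof. lia. Qed.

Lemma half_ltn i j : (i < j)%N ->
  [/\ i./2 = j./2, odd i = false & odd j = true] \/ (i./2 < j./2)%N.
Proof.
move=> ij; have [e|ne] := eqVneq i./2 j./2; [left|right]; last by lia.
by split=> //; lia.
Qed.

Section Equioscillation.
Variables (R : realType) (Theta : R) (n : nat).
Hypothesis Theta_gt0 : 0 < Theta.
Hypothesis Theta_lt : Theta < pi / 2.

Let Theta_itv : 0 <= Theta < pi / 2.
Proof. by rewrite Theta_lt ltW. Qed.

Local Notation k := (sin Theta).
Local Notation K := (ellK k).
Local Notation P := (cos_num Theta n).
Local Notation Q := (cos_den Theta n).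
Local Notation dn u := (jacobi_dn u k).

Let k_itv : 0 <= k < 1. Proof. exact: sin_Theta_itv. Qed.

Let k_gt0 : 0 < k.
Proof. by rewrite sin_gt0_pihalf // Theta_gt0 Theta_lt. Qed.

Let K_gt0 : 0 < K. Proof. exact: ellK_gt0. Qed.

Let h : R := 2 * K / (2 * n + 1)%:R.

Let h_gt0 : 0 < h.
Proof. by apply: divr_gt0; [exact: mulr_gt0|rewrite ltr0n addn1]. Qed.

Let KE : K = n%:R * h + h / 2.
Proof.
have d0 : (2 * n + 1)%:R != 0 :> R by rewrite pnatr_eq0 addn1.
by move: d0; rewrite /h natrD natrM => d0; field.
Qed.

(** The real part of r along the elliptic parametrization of the arc. *)
Let C u : R := P.[dn u] / Q.[dn u].

Let C_Re u : C u = complex.Re (circle_map (a_coef n Theta) n (zeta k u)).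
Proof. by rewrite /zeta Re_circle_map // zeta_circle. Qed.

Let CD u : C (u + h) = C u.
Proof.
have zc := zeta_circle k_itv u.
have zc' : jacobi_dn u k ^+ 2 + (- (k * jacobi_sn u k)) ^+ 2 = 1 by rewrite sqrrN.
have := circle_map_conj (a_coef_gt0 (n:=n) Theta_itv) (a_coef_neq1 (n:=n) Theta_itv) zc.
rewrite -/(zeta k u) -(circle_map_zeta_shift n Theta_itv u) => /mulfI e.
rewrite [LHS]C_Re -e; first by rewrite Re_circle_map.
apply: contra_eqN (circle_map_zeta_shift n Theta_itv u) => /eqP ->.
by rewrite mul0r eq_sym oner_eq0.
Qed.

Let CDn i u : C (u + i%:R * h) = C u.
Proof.
elim: i => [|i IHi]; first by rewrite mul0r addr0.
by rewrite -natr1 mulrDl mul1r addrA CD.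
Qed.

Let CN u : C (- u) = C u.
Proof. by rewrite /C dnN. Qed.

Let C0 : C 0 = 1.
Proof. by rewrite /C dn0 // cos_ratio1 // divff // gt_eqF // cos_den_gt0. Qed.

Let dn_le1 u : dn u <= 1.
Proof.
rewrite -(@ler_pXn2r _ 2) ?nnegrE ?(ltW (dn_gt0 _ _)) // expr1n dn2 // gerBl.
by rewrite mulr_ge0 ?sqr_ge0.
Qed.

Let C_le1 u : C u <= 1.
Proof.
apply: cos_ratio_le1 => //; rewrite dn_le1 andbT.
by rewrite (@le_trans _ _ 0) // ?lerN10 // ltW // dn_gt0.
Qed.

Let dn_cont : continuous (fun u => dn u).
Proof.
move=> u; apply: differentiable_continuous; apply/derivable1_diffP.
by have [] := is_derive_dn k_itv u.
Qed.

Let C_cont : continuous C.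
Proof.
move=> u; have horner_dn (p : {poly R}) : {for u, continuous (fun v => p.[dn v])}.
  by apply: (continuous_comp (dn_cont (x := u))); exact: continuous_horner.
apply: (@continuousM R R (fun v => P.[dn v]) (fun v => (Q.[dn v])^-1)).
  exact: horner_dn.
apply: (@continuousV R R (fun v => Q.[dn v])); last exact: horner_dn.
by rewrite gt_eqF // cos_den_gt0.
Qed.

Let dn_inj (u v : R) : 0 <= u <= K -> 0 <= v <= K -> dn u = dn v -> u = v.
Proof.
move=> /andP[u0 uK] /andP[v0 vK] e; apply/eqP; rewrite eq_le !leNgt.
by apply/andP; split; apply/negP => /dn_dec;
  [move=> /(_ _ k_itv k_gt0 v0 uK)|move=> /(_ _ k_itv k_gt0 u0 vK)]; rewrite e ltxx.
Qed.

Let num_neq0 : (re_im_num (a_coef n Theta) n).1 != 0.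
Proof.
apply/negP => /eqP p0; have := cos_ratio1 n Theta_itv.
rewrite cos_numE p0 horner0 mulr0 => e.
by have := cos_den_gt0 n Theta_itv 1; rewrite -e ltxx.
Qed.

(** If C took the value c at u1 and at u2, periodicity would give the points
    u1 + jh and u2 + jh, 0 <= j <= n, all in [0, K], and P - c Q would have 2n+2
    zeros dn (u_i + jh).  So P = c Q, which is absurd since P(0) = 0 and
    P(1) = Q(1). *)
Let C_inj (u1 u2 : R) : 0 <= u1 -> u1 < u2 -> u2 <= h / 2 -> C u1 <> C u2.
Proof.
move=> u10 u12 u2h e; set c := C u1.
(* the zeros in increasing order: u1, u2, u1 + h, u2 + h, ... *)
pose v i : R := (if odd i then u2 else u1) + (i./2)%:R * h.
have Cv i : C (v i) = c by rewrite /v CDn; case: (odd i); rewrite // -e.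
have v_itv i : (i < 2 * n + 2)%N -> 0 <= v i <= K.
  move=> ilt; have i2 := half_leq ilt.
  have : 0 <= (if odd i then u2 else u1) <= h / 2.
    by case: (odd i); apply/andP; split; lra.
  have : i./2%:R * h <= n%:R * h by rewrite ler_wpM2r ?ler_nat // ltW.
  have : 0 <= i./2%:R * h by rewrite mulr_ge0 // ltW.
  move=> h1 h2 /andP[h3 h4]; rewrite /v KE; apply/andP; split; [exact: addr_ge0|].
  by rewrite addrC lerD.
have v_inc i j : (i < j)%N -> v i < v j.
  move=> ij; have hh := h_gt0; rewrite /v.
  have [[e2 -> ->]|lt3] := half_ltn ij.
    by rewrite e2 ltrD2r.
  have : (i./2)%:R * h + h <= (j./2)%:R * h.
    by rewrite -[X in _ + X]mul1r -mulrDl ler_wpM2r ?(ltW hh) // natr1 ler_nat.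
  have : (if odd i then u2 else u1) <= h / 2 by case: (odd i); lra.
  have : 0 <= (if odd j then u2 else u1) by case: (odd j); lra.
  by lra.
have PcQ : P - c *: Q = 0.
  apply: (@roots_geq_poly_eq0 _ _ [seq dn (v i) | i <- iota 0 (2 * n + 2)]).
  - apply/allP => x /mapP[l _ ->]; apply/rootP.
    rewrite hornerD hornerN hornerZ -(Cv l) /C divfK ?subrr //.
    by rewrite gt_eqF // cos_den_gt0.
  - rewrite map_inj_in_uniq ?iota_uniq // => i j; rewrite !mem_iota => hi hj.
    move=> /(dn_inj (v_itv _ hi) (v_itv _ hj)) vij.
    by case: (ltngtP i j) => // /v_inc; rewrite vij ltxx.
  - rewrite size_map size_iota (leq_trans (size_polyD _ _)) // geq_max size_polyN.
    rewrite (leq_trans (size_cos_num _ _)) ?addn2 ?addn1 //.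
    rewrite (leq_trans (size_scale_leq _ _)) //.
    by rewrite (leq_trans (size_cos_den _ _)) ?addn1.
have c0 : c = 0.
  have := congr1 (fun p : {poly R} => p.[0]) PcQ.
  rewrite hornerD hornerN hornerZ cos_numE mul0r add0r horner0 => /eqP.
  by rewrite oppr_eq0 mulf_eq0 (gt_eqF (cos_den_gt0 _ _ _)) // orbF => /eqP.
have := congr1 (fun p : {poly R} => p.[1]) PcQ.
rewrite c0 scale0r subr0 horner0 cos_ratio1 // => e1.
by have := cos_den_gt0 n Theta_itv 1; rewrite e1 ltxx.
Qed.

(** A zero of C would be repeated n+1 times with period h, but the even part p of
    P(x) = x p(x^2) has degree at most n. *)
Let C_gt0 (u : R) : 0 <= u <= h / 2 -> 0 < C u.
Proof.
move=> /andP[u0 uh]; rewrite ltNge; apply/negP => Cu.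
have [||v] := @IVT R C 0 u 0 u0.
- by apply: continuous_subspaceT => z; exact: C_cont.
- have Cle : C u <= C 0 by rewrite C0 (le_trans Cu).
  by rewrite (min_idPr Cle) (max_idPl Cle) Cu C0 ler01.
rewrite in_itv /= => /andP[v0 vu] Cv0.
move/eqP: num_neq0; apply.
have dv_itv j : (j <= n)%N -> 0 <= v + j%:R * h <= K.
  move=> jn; rewrite KE; apply/andP; split; first by apply: addr_ge0 => //; rewrite mulr_ge0 // ltW.
  rewrite addrC; apply: lerD; last exact: le_trans vu uh.
  by rewrite ler_wpM2r ?ler_nat // ltW.
apply: (@roots_geq_poly_eq0 _ _ [seq dn (v + i%:R * h) ^+ 2 | i <- iota 0 n.+1]).
- apply/allP => x /mapP[l _ ->]; apply/rootP.
  have := CDn l v; rewrite Cv0 /C cos_numE => /eqP.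
  rewrite mulf_eq0 invr_eq0 (gt_eqF (cos_den_gt0 _ Theta_itv _)) orbF.
  by rewrite mulf_eq0 (gt_eqF (dn_gt0 k_itv _)) => /eqP.
- rewrite map_inj_in_uniq ?iota_uniq // => i j; rewrite !mem_iota => hi hj /eqP.
  rewrite eqrXn2 ?(ltW (dn_gt0 _ _)) // => /eqP.
  move=> /(dn_inj (dv_itv _ hi) (dv_itv _ hj)) /addrI /mulIf.
  by move=> /(_ (lt0r_neq0 h_gt0)) /eqP; rewrite eqr_nat => /eqP.
- by rewrite size_map size_iota; have [] := size_re_im_num (a_coef n Theta) n.
Qed.

(** The minimum of S on [l, 1]. *)
Definition osc_min : R := C (h / 2).
Local Notation mu := osc_min.

Lemma osc_min_itv : 0 < mu < 1.
Proof.
have h2 : 0 < h / 2 by rewrite divr_gt0.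
apply/andP; split; first by apply: C_gt0; rewrite lexx ltW.
rewrite lt_neqAle C_le1 andbT; apply/negP => /eqP e.
by apply: (@C_inj 0 (h / 2)) => //; rewrite C0; exact: esym e.
Qed.

(** C starts at its maximum 1; if it went below its value at h/2 before h/2, it
    would take that value twice. *)
Let C_ge_half (u : R) : 0 <= u <= h / 2 -> mu <= C u.
Proof.
move=> /andP[u0 uh]; rewrite leNgt; apply/negP => Cu.
have /andP[m0 m1] := osc_min_itv.
have [||v] := @IVT R C 0 u mu u0.
- by apply: continuous_subspaceT => z; exact: C_cont.
- have Cle : C u <= C 0 by rewrite C0.
  by rewrite (min_idPr Cle) (max_idPl Cle) C0 !ltW.
rewrite in_itv /= => /andP[v0 vu] Cv.
apply: (@C_inj v (h / 2)) => //; apply: (le_lt_trans vu).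
rewrite lt_neqAle uh andbT; apply/negP => /eqP e.
by move: Cu; rewrite e ltxx.
Qed.

(** Evenness and periodicity reduce any u to [0, h/2]. *)
Let C_ge (u : R) : 0 <= u <= K -> mu <= C u.
Proof.
rewrite KE => /andP[u0 uK].
suff gen i (v : R) : - (h / 2) <= v <= i%:R * h + h / 2 -> mu <= C v.
  by apply: (gen n); rewrite uK andbT; have := h_gt0; lra.
elim: i v => [|i IHi] v /andP[v1 v2].
  have [v0|v0] := leP 0 v.
    by apply: C_ge_half; rewrite v0 /=; move: v2; rewrite mul0r add0r.
  by rewrite -CN; apply: C_ge_half; apply/andP; split; lra.
have [vh|vh] := leP v (h / 2).
  apply: IHi; rewrite v1 (le_trans vh) // lerDr mulr_ge0 // ltW //.
have -> : v = (v - h) + h by rewrite subrK.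
rewrite CD; apply: IHi; move: v2; rewrite -natr1 mulrDl mul1r => v2.
by apply/andP; split; lra.
Qed.

(** The alternant: the points of [0, K] at which C equals mu and 1 in turn,
    counted from K downwards because dn is decreasing. *)
Let y i : R := dn (K - i%:R * (h / 2)).

Let y_arg i : (i <= 2 * n + 1)%N -> 0 <= K - i%:R * (h / 2) <= K.
Proof.
move=> ile; have h2 : 0 < h / 2 by rewrite divr_gt0.
apply/andP; split; last by rewrite gerBl mulr_ge0 // ltW.
rewrite subr_ge0; have -> : K = (2 * n + 1)%:R * (h / 2).
  by rewrite [LHS]KE natrD natrM; field.
by rewrite ler_wpM2r ?ler_nat // ltW.
Qed.

Let C_nat i : C (K - i%:R * (h / 2)) = if odd i then 1 else mu.
Proof.
rewrite -[LHS](CDn i./2) -{1}(odd_double_half i) natrD -mul2n natrM.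
case: (odd i) => /=.
  have -> : K - (1 + 2 * i./2%:R) * (h / 2) + i./2%:R * h = 0 + n%:R * h.
    by rewrite [X in X - _]KE; field.
  by rewrite CDn C0.
have -> : K - (0 + 2 * i./2%:R) * (h / 2) + i./2%:R * h = h / 2 + n%:R * h.
  by rewrite [X in X - _]KE; field.
by rewrite CDn.
Qed.

Lemma cos_ratio_endpoint : P.[cos Theta] / Q.[cos Theta] = mu.
Proof.
have := C_nat 0; rewrite mul0r subr0 /C dnK // -cos2sin2 sqrtr_sqr.
by rewrite gtr0_norm // cos_Theta_gt0.
Qed.

(** Scaling S by c = 2 / (1 + mu) makes its extreme values 1 - e and 1 + e; the
    maximum of the best approximation on [l, 1] is c, so the normalization
    returns S. *)
Lemma Rhat_odd_spec_pos :
  let r := Rhat_odd n (cos Theta) in r.2 %| Q /\ r.1 * Q = P * r.2.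
Proof.
have /andP[m0 m1] := osc_min_itv.
pose c := 2 / (1 + mu); pose e := (1 - mu) / (1 + mu).
have d0 : 0 < 1 + mu by lra.
have c0 : 0 < c by rewrite divr_gt0.
have l0 : 0 < cos Theta by exact: cos_Theta_gt0.
have dnKE : dn K = cos Theta.
  by rewrite dnK // -cos2sin2 sqrtr_sqr gtr0_norm.
have l1 : cos Theta < 1.
  rewrite -dnKE -[ltRHS](dn0 k_itv); apply: dn_dec => //.
have ran (x : R) : cos Theta <= x <= 1 -> exists2 u, 0 <= u <= K & dn u = x.
  move=> hx; have [||u uK ux] := @IVT R (fun u => dn u) 0 K x (ltW K_gt0).
  - by apply: continuous_subspaceT => z; exact: dn_cont.
  - by rewrite dn0 // dnKE (min_idPr (ltW l1)) (max_idPl (ltW l1)).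
  by exists u.
have cS x : (c *: P).[x] / Q.[x] = c * (P.[x] / Q.[x]) by rewrite hornerZ mulrA.
have [] := @minimax_sign_spec R (cos Theta) e (2 * n + 1) (c *: P) Q y.
- exact: l0.
- exact: ltW.
- by rewrite divr_gt0 // subr_gt0.
- by rewrite ltr_pdivrMr //; lra.
- by rewrite addn1 /= mul2n odd_double.
- by rewrite (leq_trans (size_scale_leq _ _)) // size_cos_num.
- exact: size_cos_den.
- by move=> x; exact: cos_den_gt0.
- by move=> x; rewrite !hornerZ cos_numN mulrN.
- exact: cos_denN.
- move=> i j ij jle; have jle' := y_arg jle.
  have ile' := y_arg (leq_trans (ltnW ij) jle).
  move: jle' ile' => /andP[? ?] /andP[? ?].
  apply: dn_dec => //; rewrite ltrD2l ltrN2 ltr_pM2r ?ltr_nat // divr_gt0 //.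
- move=> j jle; have /andP[h1 h2] := y_arg jle; rewrite /y dn_le1 andbT -dnKE.
  move: h2; rewrite le_eqVlt => /predU1P[->//|h2].
  by apply: ltW; apply: dn_dec.
- move=> j jle; rewrite cS -/(C _) C_nat /c /e -[in RHS]signr_odd.
  by case: (odd j) => /=; field; rewrite gt_eqF.
- move=> x /ran[u uK <-]; rewrite cS -/(C u).
  have := C_ge uK; have := C_le1 u; rewrite /c /e ler_norml => h1 h2.
  apply/andP; split.
    rewrite -subr_ge0.
    have -> : 2 / (1 + mu) * C u - 1 - - ((1 - mu) / (1 + mu)) = 2 * (C u - mu) / (1 + mu).
      by field; rewrite gt_eqF.
    by rewrite divr_ge0 ?(ltW d0) // mulr_ge0 // subr_ge0.
  rewrite -subr_ge0.
  have -> : (1 - mu) / (1 + mu) - (2 / (1 + mu) * C u - 1) = 2 * (1 - C u) / (1 + mu).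
    by field; rewrite gt_eqF.
  by rewrite divr_ge0 ?(ltW d0) // mulr_ge0 // subr_ge0.
rewrite /Rhat_odd (lt_eqF l1); set r := minimax_sign _ _ => cop e1.
have dvdQ : r.2 %| Q.
  rewrite -(@Gauss_dvdpr _ Q r.1 r.2); last by rewrite coprimep_sym.
  by rewrite -e1 dvdp_mull.
have r20 x : r.2.[x] != 0.
  have := cos_den_gt0 n Theta_itv x; have /dvdpP[q ->] := dvdQ.
  by rewrite hornerM; apply: contraTneq => ->; rewrite mulr0 ltxx.
have evE x : rf_eval r x = c * (P.[x] / Q.[x]).
  rewrite -cS /rf_eval; apply/eqP; rewrite eqr_div ?r20 //; last first.
    by rewrite gt_eqF // cos_den_gt0.
  by rewrite -!hornerM e1.
have supE : sup [set rf_eval r z | z in `[cos Theta, 1]] = c.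
  set S := (X in sup X); have ubc : ubound S c.
    move=> x' [z /= zi <-]; rewrite evE ler_piMr ?(ltW c0) //.
    apply: cos_ratio_le1 => //; move: zi; rewrite in_itv /= => /andP[z1 ->].
    by rewrite andbT (le_trans _ z1) // (@le_trans _ _ 0) ?lerN10 // ltW.
  have inc : S c.
    exists (1 : R); first by rewrite /= in_itv /= lexx ltW.
    by rewrite evE cos_ratio1 // divff ?mulr1 // gt_eqF // cos_den_gt0.
  apply/eqP; rewrite eq_le; apply/andP; split.
    by apply: ge_sup => //; exists c.
  by apply: ub_le_sup => //; exists c.
split=> //=; rewrite supE -scalerAl -e1 -!scalerAl scalerA mulVf ?scale1r //.
by rewrite gt_eqF.
Qed.

End Equioscillation.

(** * The case of a vanishing angle *)

Section RootsOfUnity.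
Variables (R : realType) (n : nat).
Local Notation N := (2 * n + 1)%N.

(** The primitive N-th root of unity whose powers have real part
    (-1)^i cos (i pi / N); the sign absorbs the exponents (-1)^i of the a_j. *)
Definition omega : R[i] := - expi (pi / N%:R).

Lemma expiD (s t : R) : expi (s + t) = expi s * expi t.
Proof.
by apply/eqP; rewrite eq_complex /= sinD cosD [X in _ && (X == _)]addrC !eqxx.
Qed.

Lemma expiX (t : R) i : expi t ^+ i = expi (i%:R * t).
Proof.
elim: i => [|i IHi]; first by rewrite mul0r /expi cos0 sin0.
by rewrite exprS IHi -expiD -natr1 mulrDl mul1r addrC.
Qed.

Lemma omegaX i : omega ^+ i = (-1) ^+ i * expi (i%:R * (pi / N%:R)).
Proof. by rewrite /omega [LHS]exprNn expiX. Qed.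

Let N_neq0 : N%:R != 0 :> R. Proof. by rewrite pnatr_eq0 addn1. Qed.

Lemma omega_prim : N.-primitive_root omega.
Proof.
have omegaN : omega ^+ N = 1.
  rewrite omegaX mulrCA mulfV // mulr1 /expi cospi sinpi.
  rewrite -signr_odd addn1 /= mul2n odd_double /= expr1.
  by apply/eqP; rewrite eq_complex /=; apply/andP; split; apply/eqP; ring.
apply/andP; split; first by rewrite addn1.
apply/forallP => -[i iN] /=; rewrite unity_rootE; apply/eqP.
have [->|iN'] := eqVneq i.+1 N; first by rewrite omegaN eqxx.
apply/negP => /eqP; rewrite omegaX => /(congr1 (fun z => complex.Im z)) /=.
have sE : (-1) ^+ i.+1 = ((-1) ^+ i.+1)%:C :> R[i] by rewrite rmorph_sign.
rewrite sE /= mul0r addr0 => /eqP; rewrite mulf_eq0 signr_eq0 /=.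
rewrite gt_eqF // sin_gt0_pi //; have p0 := pi_gt0 R.
have N0 : 0 < N%:R :> R by rewrite ltr0n addn1.
rewrite mulr_gt0 ?ltr0n ?divr_gt0 //= mulrCA gtr_pMr // ltr_pdivrMr // mul1r ltr_nat.
by rewrite ltn_neqAle iN'.
Qed.

(** The homogeneous form of the factorization of X^N - 1, with conjugate roots
    grouped. *)
Lemma homogeneous_unity (al be : R[i]) : be != 0 ->
  (al - be) * \prod_(1 <= i < n.+1) ((al - omega ^+ i * be) * (al - (omega ^+ i)^-1 * be))
  = al ^+ N - be ^+ N.
Proof.
move=> be0; have wN := prim_expr_order omega_prim.
have w0 : omega != 0.
  by apply: contra_eqN wN => /eqP ->; rewrite expr0n addn1 eq_sym oner_eq0.
have homo : \prod_(0 <= i < N) (al - omega ^+ i * be) = al ^+ N - be ^+ N.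
  have := congr1 (fun p : {poly R[i]} => be ^+ N * p.[al / be]) (factor_Xn_sub_1 omega_prim).
  have -> : be ^+ N * ('X^N - 1).[al / be] = al ^+ N - be ^+ N.
    by rewrite hornerD hornerN hornerC hornerXn mulrBr mulr1 -exprMn [be * _]mulrC divfK.
  move=> <-; rewrite horner_prod -[in RHS](subn0 N) -prodr_const_nat subn0 -big_split /=.
  by apply: eq_bigr => i _; rewrite hornerXsubC mulrBr mulrCA divff // mulr1 mulrC.
rewrite -homo addn1 [RHS]big_nat_recl // expr0 mul1r; congr (_ * _).
have -> : (2 * n = n + n)%N by rewrite mul2n addnn.
rewrite [RHS](@big_cat_nat _ _ _ n) ?leq_addr //=.
rewrite big_split /=; congr (_ * _).
  by rewrite big_add1.
(* the indices n+1, ..., 2n give the inverse roots in reverse order *)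
rewrite -[X in index_iota X (n + n)]add0n big_addn addnK [RHS]big_nat_rev /= big_add1 /=.
apply: eq_big_nat => i hi; congr (_ - _ * _).
apply: (@mulfI _ (omega ^+ i.+1)); first by rewrite expf_neq0.
by rewrite divff ?expf_neq0 // -exprD -wN; congr (_ ^+ _); lia.
Qed.

Lemma expi_inv (t : R) : (expi t)^-1 = cos t -i* sin t.
Proof.
have e : expi t * (cos t -i* sin t) = 1.
  apply/eqP; rewrite eq_complex /= mulrN opprK -!expr2 cos2Dsin2 eqxx /=.
  by apply/eqP; ring.
have e0 : expi t != 0.
  by apply: contra_eqN e => /eqP ->; rewrite mul0r eq_sym oner_eq0.
by apply: (mulfI e0); rewrite divff.
Qed.

Lemma omegaDV i : omega ^+ i + (omega ^+ i)^-1 =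
  (2 * ((-1) ^+ i * cos (i%:R * (pi / N%:R))))%:C.
Proof.
have sE : (-1) ^+ i = ((-1) ^+ i)%:C :> R[i] by rewrite rmorph_sign.
rewrite omegaX invfM invr_sign expi_inv -mulrDr sE.
by apply/eqP; rewrite eq_complex /=; apply/andP; split; apply/eqP; ring.
Qed.

End RootsOfUnity.

Section ThetaZero.
Variables (R : realType) (n : nat).
Local Notation N := (2 * n + 1)%N.
Local Notation a := (@a_coef R n 0).

Let itv0 : 0 <= (0 : R) < pi / 2.
Proof. by rewrite lexx divr_gt0 ?pi_gt0. Qed.

Let k0 : 0 <= (0 : R) < 1. Proof. by rewrite lexx ltr01. Qed.

Lemma am_modulus0 (u : R) : jacobi_am u 0 = u.
Proof.
have dn1 v : jacobi_dn v 0 = 1 :> R by rewrite /jacobi_dn expr0n mul0r subr0 sqrtr1.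
suff : jacobi_am u 0 - u = jacobi_am 0 0 - 0.
  by rewrite am0 // subrr => /eqP; rewrite subr_eq0 => /eqP.
apply: (@is_derive_0_is_cst _ (fun v : R => jacobi_am v 0 - v)) => v.
have dam := is_derive_am k0 v; rewrite dn1 in dam.
rewrite -[X in is_derive _ _ _ X](subrr (1 : R)).
by apply: is_deriveB.
Qed.

(** The real part of omega^i. *)
Let c_ i : R := (-1) ^+ i * cos (i%:R * (pi / N%:R)).

Lemma a_coef0E i : (0 < i <= n)%N ->
  -1 < c_ i < 1 /\ a (n.+1 - i) = (1 - c_ i) / (1 + c_ i).
Proof.
move=> hi; rewrite a_coefE // sin0 /half_ratio /jacobi_cn am_modulus0.
have K0 : ellK 0 = pi / 2 :> R by rewrite -(am_modulus0 (ellK 0)) am_ellK.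
rewrite K0 -/(c_ i).
have -> : i%:R * (2 * (pi / 2) / N%:R) = i%:R * (pi / N%:R) :> R.
  by rewrite [2 * _]mulrC divfK.
have hc : 0 < cos (i%:R * (pi / N%:R) : R) < 1.
  have := step_itv itv0 hi; rewrite sin0 K0 [2 * _]mulrC divfK // => hu.
  have hu' : 0 < (i%:R * (pi / N%:R) : R) < ellK 0 by rewrite K0.
  have := cn_gt0 k0 hu'; have := cn_lt1 k0 hu'.
  by rewrite /jacobi_cn am_modulus0 => -> ->.
rewrite /c_ -signr_odd; move: hc; move: (cos _) => c /andP[c1 c2].
case: (odd i); rewrite ?expr0 ?expr1 ?mul1r ?mulN1r; split.
- by apply/andP; split; lra.
- by rewrite opprK invf_div.
- by apply/andP; split; lra.
- by [].
Qed.

Let exprN_odd (t : R[i]) : (- t) ^+ N = - t ^+ N.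
Proof. by rewrite [LHS]exprNn -signr_odd oddD oddM /= expr1 mulN1r. Qed.

(** With al = z + 1 and be = z - 1, the factor with index i is the quotient of
    (al + w be)(al + be / w) by (al - w be)(al - be / w) for w = omega^i, and
    z = (al + be) / (al - be).  Hence r(z) = (al^N + be^N) / (al^N - be^N). *)
Lemma circle_map0 (x y : R) : x ^+ 2 + y ^+ 2 = 1 -> x +i* y != 1 ->
  circle_map a n (x +i* y) * ((x +i* y + 1) ^+ N - (x +i* y - 1) ^+ N) =
  (x +i* y + 1) ^+ N + (x +i* y - 1) ^+ N.
Proof.
move=> xy; set z := x +i* y => z1.
have be0 : z - 1 != 0 by rewrite subr_eq0.
have beN : - (z - 1) != 0 by rewrite oppr_eq0.
have oN := exprN_odd (z - 1).
have := homogeneous_unity n (z + 1) beN; rewrite oN [in RHS]opprK => <-.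
rewrite -(homogeneous_unity n (z + 1) be0).
rewrite /circle_map mulrACA big_nat_rev -big_split /=; congr (_ * _); first by ring.
apply: eq_big_nat => i hi.
have hi' : (0 < i <= n)%N by [].
have hj : (0 < n.+1 - i <= n)%N by move: hi'; clear; lia.
have -> : (1 + n.+1 - i.+1 = n.+1 - i)%N by lia.
have [/andP[c1 c2] aE] := a_coef0E hi'.
have a_gt0 := a_coef_gt0 itv0 (j := n.+1 - i) (n := n).
have a_neq1 := a_coef_neq1 itv0 (j := n.+1 - i) (n := n).
have den0 : 1 + (a (n.+1 - i))%:C * z ^+ 2 != 0.
  by apply: circle_den_neq0; rewrite ?a_gt0 ?a_neq1.
have w0 : omega R n ^+ i != 0 :> R[i].
  rewrite expf_neq0 //; apply/negP => /eqP w0.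
  have /eqP := prim_expr_order (omega_prim R n).
  by rewrite w0 expr0n addn1 eq_sym oner_eq0.
have := omegaDV R n i; rewrite -/(c_ i) => wE.
have pairE (be : R[i]) : (z + 1 - omega R n ^+ i * be) * (z + 1 - (omega R n ^+ i)^-1 * be)
    = (z + 1) ^+ 2 - (2 * c_ i)%:C * (z + 1) * be + be ^+ 2.
  by rewrite -wE; field.
rewrite !pairE; move: den0.
have -> : (a (n.+1 - i))%:C = (1 - (c_ i)%:C) / (1 + (c_ i)%:C) :> R[i].
  by rewrite aE rmorphM fmorphV rmorphB rmorphD rmorph1.
have -> : (2 * c_ i)%:C = 2 * (c_ i)%:C :> R[i] by rewrite rmorphM rmorph_nat.
have c10 : 1 + (c_ i)%:C != 0 :> R[i].
  rewrite -(rmorph1 (real_complex R)) -rmorphD fmorph_eq0 gt_eqF //.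
  by rewrite -ltrBlDl sub0r.
move: (c_ i)%:C c10 => c c10 den0.
have den1 : (1 + c) + (1 - c) * z ^+ 2 != 0.
  apply: contraNneq den0 => h; apply/eqP.
  apply: (mulfI c10); rewrite mulr0 -[RHS]h; field.
  by rewrite c10.
by field; rewrite c10.
Qed.

(** Adding the identity for z and for its conjugate w: the mixed products
    (z+1)^N (w-1)^N and (z-1)^N (w+1)^N cancel as N is odd, and
    (z+1)(w+1) = 2 (1+x), (z-1)(w-1) = 2 (1-x). *)
Lemma cos_ratio0 (x : R) : -1 < x < 1 ->
  (cos_num 0 n).[x] * ((1 + x) ^+ N + (1 - x) ^+ N) =
  (cos_den 0 n).[x] * ((1 + x) ^+ N - (1 - x) ^+ N).
Proof.
move=> /andP[x1 x2]; pose y := Num.sqrt (1 - x ^+ 2).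
have xy : x ^+ 2 + y ^+ 2 = 1.
  by rewrite sqr_sqrtr; [rewrite addrC subrK|rewrite subr_ge0; nra].
have xy' : x ^+ 2 + (- y) ^+ 2 = 1 by rewrite sqrrN.
have Q0 := cos_den_gt0 n itv0 x.
have ne1 (t : R) : x +i* t != 1.
  by apply/negP => /eqP /(congr1 (fun z => complex.Re z)) /= x11; move: x2; rewrite x11 ltxx.
have e1 := circle_map0 xy (ne1 _); have e2 := circle_map0 xy' (ne1 _).
have a_gt0 := a_coef_gt0 itv0 (n := n); have a_neq1 := a_coef_neq1 itv0 (n := n).
have sumE : circle_map a n (x +i* y) + circle_map a n (x -i* y) =
    (2 * ((cos_num 0 n).[x] / (cos_den 0 n).[x]))%:C.
  rewrite (circle_mapE a_gt0 a_neq1 xy) (circle_mapE a_gt0 a_neq1 xy') cos_numE cos_denE.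
  by apply/eqP; rewrite eq_complex /=; apply/andP; split; apply/eqP; ring.
move: e1 e2 sumE; set z := x +i* y; set w := x -i* y.
set f := circle_map _ _ z; set g := circle_map _ _ w => e1 e2 sumE.
have AA : (z + 1) ^+ N * (w + 1) ^+ N = ((2 * (1 + x)) ^+ N)%:C.
  rewrite -exprMn rmorphXn; congr (_ ^+ _).
  by apply/eqP; rewrite eq_complex /=; apply/andP; split; apply/eqP; ring: (circle_y2 xy).
have BB : (z - 1) ^+ N * (w - 1) ^+ N = ((2 * (1 - x)) ^+ N)%:C.
  rewrite -exprMn rmorphXn; congr (_ ^+ _).
  by apply/eqP; rewrite eq_complex /=; apply/andP; split; apply/eqP; ring: (circle_y2 xy).
have AB : (z + 1) ^+ N * (w - 1) ^+ N = - ((z - 1) ^+ N * (w + 1) ^+ N).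
  rewrite -!exprMn -exprN_odd; congr (_ ^+ _).
  by apply/eqP; rewrite eq_complex /=; apply/andP; split; apply/eqP; ring: (circle_y2 xy).
have key : (f + g) * (((2 * (1 + x)) ^+ N)%:C + ((2 * (1 - x)) ^+ N)%:C) =
    2 * (((2 * (1 + x)) ^+ N)%:C - ((2 * (1 - x)) ^+ N)%:C).
  rewrite -AA -BB.
  transitivity (f * ((z + 1) ^+ N - (z - 1) ^+ N) * ((w + 1) ^+ N - (w - 1) ^+ N) +
      g * ((w + 1) ^+ N - (w - 1) ^+ N) * ((z + 1) ^+ N - (z - 1) ^+ N)).
    transitivity ((f + g) * ((z + 1) ^+ N * (w + 1) ^+ N + (z - 1) ^+ N * (w - 1) ^+ N -
      ((z + 1) ^+ N * (w - 1) ^+ N + (z - 1) ^+ N * (w + 1) ^+ N))).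
      by rewrite AB addNr subr0.
    by ring.
  by rewrite e1 e2; ring.
move: key; rewrite sumE => /(congr1 (fun z => complex.Re z)) /=.
rewrite !exprMn => key.
have p2 : 2 ^+ N != 0 :> R by rewrite expf_neq0.
move: key Q0; move: (_.[x]) (_.[x]) ((1 + x) ^+ N) ((1 - x) ^+ N) => p q A B key Q0.
have {}key : 2 * (q / p) * (2 ^+ N * A + 2 ^+ N * B) = 2 * (2 ^+ N * A - 2 ^+ N * B).
  by move: key; rewrite !addr0 !subr0 !mul0r !subr0.
apply: (@mulfI _ (2 * 2 ^+ N)); first by rewrite mulf_neq0.
transitivity (p * (2 * (q / p) * (2 ^+ N * A + 2 ^+ N * B))).
  by field; rewrite gt_eqF.
by rewrite key; ring.
Qed.

(** Agreement on an interval makes the two polynomials equal. *)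
Lemma cos_num_den0 :
  cos_num 0 n * ((1 + 'X) ^+ N + (1 - 'X) ^+ N) =
  cos_den 0 n * ((1 + 'X) ^+ N - (1 - 'X) ^+ N) :> {poly R}.
Proof.
apply/eqP; rewrite -subr_eq0; apply/eqP; set D := _ - _.
pose x_ i : R := (i.+2%:R)^-1.
have x_itv i : 0 < x_ i < 1.
  by rewrite /x_ invr_gt0 ltr0n /= invf_lt1 ?ltr0n // ltr1n.
apply: (@roots_geq_poly_eq0 _ D [seq x_ i | i <- iota 0 (size D)]).
- apply/allP => x /mapP[i _ ->]; apply/rootP.
  have /andP[h1 h2] := x_itv i.
  have hp : (1 + 'X : {poly R}).[x_ i] = 1 + x_ i by rewrite hornerD hornerX -[1]/(1%:P) hornerC.
  have hm : (1 - 'X : {poly R}).[x_ i] = 1 - x_ i by rewrite hornerD hornerN hornerX -[1]/(1%:P) hornerC.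
  rewrite /D hornerD hornerN [X in X - _]hornerM [X in _ - X]hornerM.
  rewrite [X in _ * X - _]hornerD [X in _ - _ * X]hornerD hornerN !horner_exp hp hm.
  by rewrite cos_ratio0 ?subrr // h2 andbT (lt_trans _ h1) // oppr_lt0.
- rewrite map_inj_uniq ?iota_uniq // => i j /invr_inj /eqP.
  by rewrite eqr_nat => /eqP [].
- by rewrite size_map size_iota.
Qed.

End ThetaZero.

(** * Pade approximation of the inverse square root *)

Section Pade.
Variable R : realType.
Implicit Types (p q : {poly R}).

Lemma poly_factor_at p (x : R) : p != 0 ->
  exists m q, q.[x] != 0 /\ p = q * ('X - x%:P) ^+ m.
Proof.
move=> p0; have [m [q]] := multiplicity_XsubC p x.
by rewrite p0 /= => q1 pE; exists m, q.
Qed.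

Lemma horner_norm_cvg p (x : R) : (fun z : R => `|p.[z]|) @ x --> `|p.[x]|.
Proof. by apply: cvg_norm; exact: continuous_horner. Qed.

Lemma horner_norm_gt p (x c : R) : c < `|p.[x]| -> \forall z \near x^', c < `|p.[z]|.
Proof.
move=> h; have := cvgr_gt _ (@horner_norm_cvg p x) c h => H; exact: (@nbhs_dnbhs _ x _ (H _)).
Qed.

Lemma horner_norm_lt p (x c : R) : `|p.[x]| < c -> \forall z \near x^', `|p.[z]| < c.
Proof.
by move=> h; have := cvgr_lt _ (@horner_norm_cvg p x) c h => H; exact: (@nbhs_dnbhs _ x _ (H _)).
Qed.

Lemma horner_neq0_near p (x : R) : p != 0 -> \forall z \near x^', p.[z] != 0.
Proof.
move=> /(poly_factor_at x)[m [q [qx ->]]].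
have qn : \forall z \near x^', 0 < `|q.[z]|.
  by apply: horner_norm_gt; rewrite normr_gt0.
have xn := nbhs_dnbhs_neq x.
apply: filterS2 qn xn => z; rewrite normr_gt0 => qz zx.
by rewrite hornerM horner_exp mulf_neq0 // expf_neq0 // hornerXsubC subr_eq0.
Qed.

(** A nonzero polynomial of degree below m has a zero of order j < m at x, and
    then |p(z)| is at least of size |z - x|^j. *)
Lemma flat_poly_eq0 p (x c : R) m : (size p <= m)%N ->
  (\forall z \near x^', `|p.[z]| <= c * `|(z - x) ^+ m|) -> p = 0.
Proof.
move=> sp flat; apply/eqP; apply: contraT => p0.
have [j [q [q1 pE]]] := poly_factor_at x p0.
have q0 : q != 0 by apply: contraNneq q1 => ->; rewrite horner0.
have jm : (j < m)%N.
  apply: leq_trans sp; rewrite pE size_Mmonic ?monic_exp ?monicXsubC //.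
  by rewrite size_exp_XsubC addnS /= -[X in (X < _)%N]add0n ltn_add2r size_poly_gt0.
pose d := `|q.[x]| / 2.
have d0 : 0 < d by rewrite divr_gt0 // normr_gt0.
have qn : \forall z \near x^', d < `|q.[z]|.
  by apply: horner_norm_gt; rewrite /d; move: d0; rewrite /d; lra.
(* closer than e to x, the bound (|c| + 1) |z - x| stays below d *)
pose e := Num.min 1 (d / (`|c| + 1)).
have c1 : 0 < `|c| + 1 by rewrite ltr_wpDl.
have e0 : 0 < e by rewrite lt_min ltr01 divr_gt0.
have en := dnbhs_ball x e0.
have [z [[[zp zq] ze] zx]] := filter_ex (filterI (filterI (filterI flat qn) en)
  (nbhs_dnbhs_neq x)).
move: ze => [ze _]; move: ze; rewrite /ball /= distrC lt_min => /andP[z1 zc].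
have zx0 : 0 < `|z - x| by rewrite normr_gt0 subr_eq0.
move: zp; rewrite pE hornerM horner_exp hornerXsubC normrM !normrX.
rewrite -(subnK jm) addnS -addSn exprD mulrA ler_pM2r ?exprn_gt0 // => zp.
have zm : `|z - x| ^+ (m - j.+1).+1 <= `|z - x|.
  by rewrite exprS ler_piMr // exprn_ile1 // ltW.
have : `|q.[z]| <= (`|c| + 1) * `|z - x|.
  apply: (le_trans zp); apply: (@le_trans _ _ (`|c| * `|z - x| ^+ (m - j.+1).+1)).
    by rewrite ler_wpM2r ?exprn_ge0 // ler_norm.
  by apply: ler_pM => //; rewrite ?exprn_ge0 ?lerDl.
move: zc; rewrite ltr_pdivlMr // mulrC => zc zq2.
by have := lt_le_trans (lt_trans zc zq) zq2; rewrite ltxx.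
Qed.

(** Only a punctured neighbourhood of 1 matters, so that denominators that vanish
    at 1 are covered as well. *)
Lemma pade_uniqueness (s : R -> R) n p q p' q' (c c' : R) :
  (size p <= n.+1)%N -> (size q <= n.+1)%N -> q != 0 ->
  (size p' <= n.+1)%N -> (size q' <= n.+1)%N -> q' != 0 ->
  (\forall z \near (1 : R)^', `|p.[z] / q.[z] - s z| <= c * `|(z - 1) ^+ (2 * n + 1)|) ->
  (\forall z \near (1 : R)^', `|p'.[z] / q'.[z] - s z| <= c' * `|(z - 1) ^+ (2 * n + 1)|) ->
  p * q' = p' * q.
Proof.
move=> sp sq q0 sp' sq' q0' h h'; apply/eqP; rewrite -subr_eq0; apply/eqP.
pose B := `|(q * q').[1]| + 1.
have hB : `|(q * q').[1]| < B by rewrite ltrDl.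
have B0 : 0 < B by rewrite ltr_wpDl.
apply: (@flat_poly_eq0 _ 1 (B * (c + c')) (2 * n + 1)).
  apply: (leq_trans (size_polyD _ _)); rewrite size_polyN geq_max.
  by apply/andP; split; apply: (leq_trans (size_polyMleq _ _));
    [move: sp sq'|move: sp' sq]; rewrite -!subn1; move: (size _) (size _) => i j; lia.
apply: filterS2 (filterI h h') (filterI (horner_norm_lt hB)
  (filterI (horner_neq0_near 1 q0) (horner_neq0_near 1 q0'))).
move=> z [h1 h2] [hq [qz qz']].
have -> : (p * q' - p' * q).[z] =
    (q * q').[z] * ((p.[z] / q.[z] - s z) - (p'.[z] / q'.[z] - s z)).
  by rewrite hornerD hornerN !hornerM; field; rewrite qz qz'.
rewrite normrM -mulrA; apply: ler_pM => //; first exact: ltW.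
by rewrite mulrDl (le_trans (ler_normB _ _)) // lerD.
Qed.

Variable n : nat.
Local Notation a := (@a_coef R n 0).
Local Notation p0 := (re_im_num a n).1.
Local Notation q0 := (sq_den a n).
Local Notation N := (2 * n + 1)%N.

Let itv0 : 0 <= (0 : R) < pi / 2.
Proof. by rewrite lexx divr_gt0 ?pi_gt0. Qed.

Let q0_gt0 (z : R) : 0 <= z -> 0 < q0.[z].
Proof.
move=> z0; rewrite -(sqr_sqrtr z0) -cos_denE.
exact: cos_den_gt0.
Qed.

(** With x = sqrt z, the difference is (S(x) - 1) / x and S(x) - 1 equals
    - 2 (1-x)^N / ((1+x)^N + (1-x)^N).  On the given interval x lies in
    ]1/2, 3/2[ and the denominator is at least 1/2, whence the constant 8. *)
Let flat0 (z : R) : 1 / 4 < z -> z < 9 / 4 ->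
  `|p0.[z] / q0.[z] - (Num.sqrt z)^-1| <= 8 * `|(z - 1) ^+ N|.
Proof.
move=> z1 z2; have z0 : 0 <= z by lra.
pose x := Num.sqrt z; have xx : x ^+ 2 = z by rewrite sqr_sqrtr.
have x0 : 0 <= x by exact: sqrtr_ge0.
have x1 : 1 / 2 < x by rewrite ltNge; apply/negP => h; nra.
have x2 : x < 3 / 2 by rewrite ltNge; apply/negP => h; nra.
have Qx := q0_gt0 z0.
have := congr1 (fun f : {poly R} => f.[x]) (cos_num_den0 R n).
have hp : (1 + 'X : {poly R}).[x] = 1 + x by rewrite hornerD hornerX -[1]/(1%:P) hornerC.
have hm : (1 - 'X : {poly R}).[x] = 1 - x by rewrite hornerD hornerN hornerX -[1]/(1%:P) hornerC.
rewrite /= [LHS]hornerM [RHS]hornerM cos_numE cos_denE xx.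
rewrite !hornerD hornerN !horner_exp hp hm => e.
have d1 : `|1 - x| <= 1 / 2 by rewrite ler_norml; apply/andP; split; lra.
have dN : `|(1 - x) ^+ N| <= 1 / 2.
  rewrite normrX addn1 exprS (le_trans _ d1) // ler_piMr // exprn_ile1 //.
  by rewrite (le_trans d1) //; lra.
have W1 : 1 <= (1 + x) ^+ N by rewrite exprn_ege1 //; lra.
have dz : `|(1 - x) ^+ N| <= `|(z - 1) ^+ N|.
  rewrite !normrX lerXn2r ?nnegrE // -xx.
  have -> : x ^+ 2 - 1 = (1 + x) * - (1 - x) by ring.
  by rewrite normrM normrN ler_peMl // ger0_norm; lra.
move: e dN W1 dz; move: ((1 + x) ^+ N) ((1 - x) ^+ N) ((z - 1) ^+ N) => A B D e dN W1 dz.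
have AB : 1 / 2 <= A + B.
  by move: dN; rewrite ler_norml => /andP[]; lra.
have -> : p0.[z] / q0.[z] - x^-1 = - (2 * B) / (x * (A + B)).
  have -> : p0.[z] / q0.[z] = (A - B) / (x * (A + B)).
    apply: (@mulIf _ (q0.[z] * (x * (A + B)))).
      by rewrite !mulf_neq0 // gt_eqF //; lra.
    transitivity (x * p0.[z] * (A + B)); first by field; rewrite !gt_eqF //; lra.
    by rewrite e; field; rewrite !gt_eqF //; lra.
  by field; rewrite !gt_eqF //; lra.
have xAB : 1 / 4 <= x * (A + B) by nra.
rewrite normrM normfV normrN normrM (ger0_norm (x := 2)) // (ger0_norm (x := x * _)); last by lra.
rewrite ler_pdivrMr; last by lra.
have := normr_ge0 D; nra.
Qed.

Let q0_neq0 : q0 != 0.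
Proof. by apply: contraTneq (q0_gt0 ler01) => ->; rewrite horner0 ltxx. Qed.

Let near_window : \forall z \near (1 : R), 1 / 4 < z /\ z < 9 / 4.
Proof.
have h : (1 : R) \in `]1 / 4, 9 / 4[ by rewrite in_itv /=; apply/andP; split; lra.
by apply: filterS (near_in_itvoo h) => z; rewrite in_itv /= => /andP.
Qed.

Lemma pade_invsqrt_spec :
  let r := pade_invsqrt R n in r.2 %| q0 /\ r.1 * q0 = p0 * r.2.
Proof.
pose g := gcdp p0 q0; pose r0 : ratfun R := (p0 %/ g, q0 %/ g).
have g0 : g != 0 by rewrite gcdp_eq0 (negPf q0_neq0) andbF.
have pE : p0 = r0.1 * g by rewrite /r0 /= divpK // dvdp_gcdl.
have qE : q0 = r0.2 * g by rewrite /r0 /= divpK // dvdp_gcdr.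
have r0E (z : R) : 0 <= z -> rf_eval r0 z = p0.[z] / q0.[z].
  move=> z0; have := q0_gt0 z0; rewrite /rf_eval pE qE !hornerM => h.
  have gz : g.[z] != 0 by apply: contraTneq h => ->; rewrite mulr0 ltxx.
  have rz : r0.2.[z] != 0 by apply: contraTneq h => ->; rewrite mul0r ltxx.
  by field; rewrite gz rz.
have pade0 : is_pade_invsqrt n r0.
  split.
    split; rewrite /r0 /=.
    - by rewrite (leq_trans (leq_divp _ _)) // (size_re_im_num _ _).1.
    - by rewrite (leq_trans (leq_divp _ _)) // size_sq_den.
    - by apply: contraNneq q0_neq0 => h; rewrite qE /= h mul0r.
    - by rewrite coprimep_div_gcd // q0_neq0 orbT.
  apply/eqO_exP; exists 8 => //.
  apply: filterS near_window => z [z1 z2].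
  by rewrite r0E ?flat0 //; lra.
rewrite /pade_invsqrt; case: xgetP => [r _ [[sr1 sr2 r20 cop] /eqO_exP[c c0 hc]]|]; last first.
  by move=> /(_ r0).
have e : r.1 * q0 = p0 * r.2.
  apply: (@pade_uniqueness (fun z => (Num.sqrt z)^-1) n _ _ _ _ c 8) => //.
  - exact: (size_re_im_num _ _).1.
  - exact: size_sq_den.
  - exact: nbhs_dnbhs hc.
  - apply: nbhs_dnbhs; apply: filterS near_window => z [z1 z2].
    exact: flat0.
split=> //; rewrite -(@Gauss_dvdpr _ q0 r.1 r.2); last by rewrite coprimep_sym.
by rewrite e dvdp_mull.
Qed.

Lemma Rhat_odd_spec0 :
  let r := Rhat_odd n (1 : R) in
  r.2 %| cos_den 0 n /\ r.1 * cos_den 0 n = cos_num 0 n * r.2.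
Proof.
rewrite /Rhat_odd eqxx /=; have [dvd e] := pade_invsqrt_spec.
split.
  by rewrite /cos_den; have /dvdpP[q E] := dvd; rewrite E comp_polyM dvdp_mull.
by rewrite /cos_den /cos_num -!mulrA -!comp_polyM e.
Qed.

End Pade.

Lemma Rhat_odd_spec (R : realType) (n : nat) (Theta : R) : 0 <= Theta < pi / 2 ->
  let r := Rhat_odd n (cos Theta) in
  r.2 %| cos_den Theta n /\ r.1 * cos_den Theta n = cos_num Theta n * r.2.
Proof.
move=> /andP[]; rewrite le_eqVlt => /predU1P[<- _|t0 t1].
  by rewrite cos0; exact: Rhat_odd_spec0.
exact: Rhat_odd_spec_pos.
Qed.

(** * The coupled iterations *)

Section Argument.
Variable R : realType.

(** The principal argument exists because z is on the circle, and a positive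
    cosine confines it to ]- pi/2, pi/2[. *)
Lemma arg_spec (z : R[i]) : complex.Re z ^+ 2 + complex.Im z ^+ 2 = 1 ->
  0 < complex.Re z -> 0 <= `|arg z| < pi / 2 /\ cos `|arg z| = complex.Re z.
Proof.
case: z => x y /= xy x0; have p0 := pi_gt0 R.
have nz : `|x +i* y| = 1 by rewrite normc_def /= xy sqrtr1.
have x1 : -1 <= x <= 1 by apply/andP; split; nra.
have x1' : -1 <= x < 1 \/ x = 1 by move: x1 => /andP[? ?]; case: (ltP x 1) => ?; [left|right]; lra.
(* acos only covers the upper half circle *)
pose t := if 0 <= y then acos x else - acos x.
have ac0 := acos_ge0 x1; have acpi := acos_lepi x1.
have yE : sin (acos x) = `|y|.
  rewrite sin_acos //; have -> : 1 - x ^+ 2 = y ^+ 2 by rewrite -xy addrC addKr.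
  exact: sqrtr_sqr.
have tE : x +i* y = expi t.
  rewrite /t /expi; case: (leP 0 y) => hy.
    by rewrite yE acosK ?in_itv // ger0_norm.
  by rewrite cosN sinN yE acosK ?in_itv // ltr0_norm // opprK.
have t_itv : - pi < t <= pi.
  have acp : acos x < pi by apply: acos_ltpi; rewrite (lt_le_trans _ (ltW x0)) ?ltrN10 //=; case/andP: x1.
  by rewrite /t; case: ifP => _; apply/andP; split; lra.
rewrite /arg; case: xgetP => [u _ [/andP[u1 u2]]|]; last first.
  by move=> /(_ t) []; split=> //; rewrite nz mul1r.
rewrite nz mul1r => /(congr1 (fun z => complex.Re z)) /= xE.
have cu : cos `|u| = x by rewrite cos_norm.
split=> //; rewrite normr_ge0 /= ltNge; apply/negP => hu.
have upi : `|u| <= pi by rewrite ler_norml ltW.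
suff : cos `|u| <= cos (pi / 2) by rewrite cu cos_pihalf leNgt x0.
rewrite leNgt; apply/negP; rewrite ltr_cos ?in_itv /=.
- by rewrite ltNge hu.
- by apply/andP; split; lra.
- by apply/andP; split; lra.
Qed.

End Argument.

Section Step.
Variables (R : realType) (n : nat) (Theta : R).
Hypothesis Theta_itv : 0 <= Theta < pi / 2.
Local Notation P := (cos_num Theta n).
Local Notation Q := (cos_den Theta n).
Local Notation r := (Rhat_odd n (cos Theta)).

(** The quotient s.1 / s.2 is a reduced form of p / q: its poles are among those
    of p / q, and the values agree. *)
Lemma rf_eval_same (F : fieldType) (s : ratfun F) (p q : {poly F}) (x : F) :
  s.2 %| q -> s.1 * q = p * s.2 -> q.[x] != 0 ->
  rf_defined s x /\ rf_eval s x = p.[x] / q.[x].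
Proof.
move=> /dvdpP[g qE] e qx.
have sx : s.2.[x] != 0 by apply: contraNneq qx => h; rewrite qE hornerM h mulr0.
split=> //; rewrite /rf_eval; apply/eqP; rewrite eqr_div // -!hornerM.
by rewrite e.
Qed.

Lemma Rhat_odd_eval (x : R) :
  rf_defined r x /\ rf_eval r x = P.[x] / Q.[x].
Proof.
have [dvd e] := Rhat_odd_spec n Theta_itv.
by apply: rf_eval_same => //; rewrite gt_eqF // cos_den_gt0.
Qed.

Lemma rf_complexE (s : ratfun R) (x : R) :
  rf_defined (rf_complex s) x%:C = rf_defined s x /\
  rf_eval (rf_complex s) x%:C = (rf_eval s x)%:C.
Proof.
by rewrite /rf_defined /rf_eval /rf_complex /= !horner_map /= fmorph_eq0 fmorph_div.
Qed.

(** The scalar identity behind the proposition. *)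
Lemma r_odd_step (x y : R) : x ^+ 2 + y ^+ 2 = 1 ->
  let f := rf_eval (rf_complex (r_odd n Theta)) (x +i* y) in
  [/\ complex.Re f ^+ 2 + complex.Im f ^+ 2 = 1, complex.Re f = rf_eval r x &
      rf_defined (rf_complex (r_odd n Theta)) (x +i* y)].
Proof.
move=> xy; rewrite /= r_odd_evalE; split; last exact: r_odd_defined.
  by apply: circle_map_unit => // j hj; [exact: a_coef_gt0|exact: a_coef_neq1].
by rewrite Re_circle_map // (Rhat_odd_eval x).2.
Qed.

Lemma Theta_step :
  let Theta' := `|arg (rf_eval (rf_complex (r_odd n Theta)) (expi Theta))| in
  0 <= Theta' < pi / 2 /\ cos Theta' = rf_eval r (cos Theta).
Proof.
have [f1 fr _] := r_odd_step (cos2Dsin2 Theta).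
rewrite -fr /=; apply: arg_spec => //; rewrite fr (Rhat_odd_eval _).2.
have /andP[] := Theta_itv; rewrite le_eqVlt => /predU1P[<- _|t0 t1].
  rewrite cos0 cos_ratio1 ?divff ?gt_eqF ?cos_den_gt0 //.
    by rewrite lexx divr_gt0 ?pi_gt0.
  by rewrite lexx divr_gt0 ?pi_gt0.
by rewrite cos_ratio_endpoint //; have /andP[] := osc_min_itv n t0 t1.
Qed.

End Step.

Section Diagonalized.
Variables (R : realType) (m : nat) (V : 'M[R[i]]_m.+1).
Hypothesis V_unitary : V \is unitarymx.
Implicit Types d e : 'rV[R[i]]_m.+1.

(** The matrix with eigenvalues d in the fixed orthonormal eigenbasis V. *)
Definition spec d : 'M[R[i]]_m.+1 := invmx V *m diag_mx d *m V.

Let V_unit : V \in unitmx. Proof. exact: unitarymx_unit. Qed.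

Lemma spec1 : spec (const_mx 1) = 1%:M.
Proof. by rewrite /spec diag_const_mx mulmx1 mulVmx. Qed.

Lemma specM d e : spec d *m spec e = spec (\row_j (d 0 j * e 0 j)).
Proof.
rewrite /spec -!mulmxA (mulmxA V) mulmxV // mul1mx (mulmxA (diag_mx d)).
by congr (_ *m (_ *m _)); rewrite mulmx_diag.
Qed.

Lemma spec_inj d e : spec d = spec e -> d = e.
Proof.
move=> h; have : diag_mx d = diag_mx e.
  have inv f : V *m spec f *m invmx V = diag_mx f.
    by rewrite /spec !mulmxA mulmxV // mul1mx mulmxK.
  by rewrite -inv h inv.
move=> /matrixP h'; apply/rowP => j.
by have := h' j j; rewrite !mxE eqxx.
Qed.

Lemma horner_spec d (p : {poly R[i]}) :
  horner_mx (spec d) p = spec (map_mx (horner p) d).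
Proof. by rewrite /spec mxpoly.horner_mx_uconjC // horner_mx_diag. Qed.

Lemma spec_unit d : (forall j, d 0 j != 0) ->
  spec d \in unitmx /\ invmx (spec d) = spec (map_mx GRing.inv d).
Proof.
move=> d0; have e : spec d *m spec (map_mx GRing.inv d) = 1%:M.
  rewrite specM -spec1; congr spec; apply/rowP => j.
  by rewrite !mxE divff.
have [u _] := mulmx1_unit e.
by split=> //; rewrite -[LHS]mulmx1 -e mulmxA mulVmx // mul1mx.
Qed.

Lemma rf_eval_spec (s : ratfun R[i]) d : (forall j, rf_defined s (d 0 j)) ->
  rf_defined_mx s (spec d) /\ rf_eval_mx s (spec d) = spec (map_mx (rf_eval s) d).
Proof.
move=> sd; rewrite /rf_defined_mx /rf_eval_mx !horner_spec.
have [|u ->] := @spec_unit (map_mx (horner s.2) d).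
  by move=> j; rewrite mxE; exact: sd.
split=> //; rewrite specM; congr spec; apply/rowP => j.
by rewrite !mxE.
Qed.

Lemma spec_adj d : (spec d) ^t* = spec (\row_j (complex.Re (d 0 j) -i* complex.Im (d 0 j))).
Proof.
rewrite /spec (invmx_unitary V_unitary) !trmx_mul !map_mxM /= trmxCK mulmxA.
congr (_ *m _ *m _); rewrite tr_diag_mx map_diag_mx; congr diag_mx.
by apply/rowP => j; rewrite !mxE; case: (d 0 j).
Qed.

Lemma spec_Re d :
  2^-1 *: (spec d + (spec d) ^t*) = spec (\row_j (complex.Re (d 0 j))%:C).
Proof.
rewrite spec_adj /spec -mulmxDl -mulmxDr -raddfD /= scalemxAl scalemxAr -linearZ.
congr (_ *m _ *m _); congr diag_mx; apply/rowP => j; rewrite !mxE.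
case: (d 0 j) => x y /=; apply: (@mulfI _ 2); first by rewrite pnatr_eq0.
rewrite mulrA divff ?pnatr_eq0 // mul1r.
by apply/eqP; rewrite eq_complex /=; apply/andP; split; apply/eqP; ring.
Qed.

End Diagonalized.

(** A unitary matrix is normal, so the spectral theorem applies. *)
Lemma unitary_spec (R : realType) (m : nat) (A : 'M[R[i]]_m.+1) :
  A \is unitarymx -> exists2 V : 'M[R[i]]_m.+1, V \is unitarymx & exists2 d,
    A = spec V d & forall j, complex.Re (d 0 j) ^+ 2 + complex.Im (d 0 j) ^+ 2 = 1.
Proof.
move=> uA; have AA := unitarymxP uA.
have nA : A \is normalmx.
  by apply/normalmxP; rewrite AA; symmetry; exact: mulmx1C.
have /orthomx_spectralP AE := nA.
exists (spectralmx A); first exact: spectral_unitarymx.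
exists (spectral_diag A); first exact: AE.
have uV := spectral_unitarymx A.
have : spec (spectralmx A) (spectral_diag A) *m (spec (spectralmx A) (spectral_diag A)) ^t* = 1%:M.
  by rewrite /spec -AE.
rewrite spec_adj // specM // -(spec1 uV) => /(spec_inj uV) /rowP h j.
have := h j; rewrite !mxE; case: (spectral_diag A 0 j) => x y /=.
by move=> /(congr1 (fun z => complex.Re z)) /= <-; ring.
Qed.

Theorem proposition3p3 (R : realType) (m : nat) (A : 'M[R[i]]_m.+1)
  (hA : A \is unitarymx)
  (hAi : ~~ eigenvalue A 'i) (hANi : ~~ eigenvalue A (- 'i))
  (n : nat) (Theta0 : R) (hTheta0 : 0 <= Theta0 < pi / 2)
  (X Y : nat -> 'M[R[i]]_m.+1) (Theta ell : nat -> R)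
  (hX0 : X 0%N = A)
  (hX : forall k, X k.+1 = rf_eval_mx (rf_complex (r_odd n (Theta k))) (X k))
  (hT0 : Theta 0%N = Theta0)
  (hT : forall k, Theta k.+1 =
     `|arg (rf_eval (rf_complex (r_odd n (Theta k))) (expi (Theta k)))|)
  (hY0 : Y 0%N = 2^-1 *: (A + A ^t*))
  (hY : forall k, Y k.+1 = rf_eval_mx (rf_complex (Rhat_odd n (ell k))) (Y k))
  (hl0 : ell 0%N = cos Theta0)
  (hl : forall k, ell k.+1 = rf_eval (Rhat_odd n (ell k)) (ell k)) :
  forall k : nat,
    (* both iterations are well defined at step k *)
    [/\ 0 <= Theta k < pi / 2,
        rf_defined_mx (rf_complex (r_odd n (Theta k))) (X k) &
        rf_defined (rf_complex (r_odd n (Theta k))) (expi (Theta k))] /\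
    [/\ 0 < ell k <= 1,
        rf_defined_mx (rf_complex (Rhat_odd n (ell k))) (Y k) &
        rf_defined (Rhat_odd n (ell k)) (ell k)] /\
    Y k = 2^-1 *: (X k + (X k) ^t*) /\ ell k = cos (Theta k).
Proof.
have [V uV [d0 AE d0_unit]] := unitary_spec hA.
have inv k : [/\ 0 <= Theta k < pi / 2, ell k = cos (Theta k) &
    exists d, [/\ X k = spec V d, Y k = spec V (\row_j (complex.Re (d 0 j))%:C) &
      forall j, complex.Re (d 0 j) ^+ 2 + complex.Im (d 0 j) ^+ 2 = 1]].
  elim: k => [|k [Tk lk [d [Xk Yk d_unit]]]].
    by split; rewrite ?hT0 ?hl0 //; exists d0; split; rewrite ?hX0 ?hY0 // AE spec_Re.
  have [T1 c1] := Theta_step n Tk.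
  split; [by rewrite hT|by rewrite hT hl c1 lk|].
  have step j := r_odd_step n Tk (d_unit j).
  have dE j : d 0 j = complex.Re (d 0 j) +i* complex.Im (d 0 j) by case: (d 0 j).
  exists (map_mx (rf_eval (rf_complex (r_odd n (Theta k)))) d); split.
  - rewrite hX Xk.
    have [|_ ->] // := @rf_eval_spec R m V uV (rf_complex (r_odd n (Theta k))) d.
    by move=> j; rewrite dE; have [] := step j.
  - rewrite hY Yk lk.
    set e := \row_j _; have [|_ ->] := @rf_eval_spec R m V uV
      (rf_complex (Rhat_odd n (cos (Theta k)))) e.
      by move=> j; rewrite mxE (rf_complexE _ _).1; have [] := Rhat_odd_eval n Tk (complex.Re (d 0 j)).
    congr spec; apply/rowP => j; rewrite !mxE (rf_complexE _ _).2 [d 0 j in RHS]dE.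
    by have [_ -> _] := step j.
  - by move=> j; rewrite mxE dE; have [] := step j.
move=> k; have [Tk lk [d [Xk Yk d_unit]]] := inv k.
split; [|split; [|split=> //]].
- split=> //; last by rewrite /expi; have [] := r_odd_step n Tk (cos2Dsin2 (Theta k)).
  rewrite Xk; apply: (@rf_eval_spec R m V uV _ d _).1 => j.
  have -> : d 0 j = complex.Re (d 0 j) +i* complex.Im (d 0 j) by case: (d 0 j).
  by have [] := r_odd_step n Tk (d_unit j).
- rewrite lk; split; first by rewrite cos_Theta_gt0 ?cos_le1.
    rewrite Yk; apply: (@rf_eval_spec R m V uV _ _ _).1 => j.
    by rewrite mxE (rf_complexE _ _).1; have [] := Rhat_odd_eval n Tk (complex.Re (d 0 j)).
  by have [] := Rhat_odd_eval n Tk (cos (Theta k)).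
- by rewrite Xk Yk spec_Re.
Qed.
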